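(* For every integer $k$, there are only finitely many simple holomorphic eta quotients of weight $k/2$; that is, the set of all simple holomorphic eta quotients of weight $k/2$ (of arbitrary level) is finite.
   Context: Let $\mathfrak{H}=\{z\in\mathbb{C}: \operatorname{Im}(z)>0\}$ and let $\eta(z)=q^{1/24}\prod_{n=1}^\infty(1-q^n)$, where $q^r=e^{2\pi i r z}$, be the Dedekind eta function on $\mathfrak{H}$. For a positive integer $d$ put $\eta_d(z)=\eta(dz)$. An eta quotient is a function on $\mathfrak{H}$ given by a finite product $f=\prod_{d}\eta_d^{X_d}$ with $d$ ranging over positive integers and $X_d\in\mathbb{Z}$ (the exponents are uniquely determined by $f$). Its weight is $\frac12\sum_d X_d$ and its level is $N=\operatorname{lcm}\{d: X_d\neq 0\}$. For a positive integer $M$, an eta quotient on $\Gamma_0(M)$ is an eta quotient whose level divides $M$. An eta quotient of level $N$ is called holomorphic if it has no pole at any cusp of $\Gamma_0(N)$. (For an eta quotient $f=\prod_{d\mid M}\eta_d^{X_d}$ on $\Gamma_0(M)$, the order at a cusp $a/t$ with $t\mid M$, $\gcd(a,t)=1$, is $\frac1{24}\sum_{d\mid M}\frac{M\gcd(d,t)^2}{d\,\gcd(t^2,M)}X_d$, so holomorphy means that these numbers are nonnegative for all $t\mid M$.) An eta quotient $f$ is primitive if there do not exist an eta quotient $h\neq f$ and a positive integer $\nu$ such that $f(z)=h(\nu z)$ for all $z\in\mathfrak{H}$. A holomorphic eta quotient $f$ on $\Gamma_0(M)$ is factorizable on $\Gamma_0(M)$ if $f=g\cdot h$ for some nonconstant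 holomorphic eta quotients $g,h$ on $\Gamma_0(M)$. A holomorphic eta quotient of level $N$ is quasi-irreducible if it is not factorizable on $\Gamma_0(N)$. A holomorphic eta quotient is simple if it is both primitive and quasi-irreducible. *)

(* Defs.v *)
From HB Require Import structures.
From mathcomp Require Export all_boot all_order all_algebra finmap.
From mathcomp Require Export all_classical all_reals all_analysis.
From mathcomp Require Export complex.
Export numFieldNormedType.Exports.
Import Order.TTheory GRing.Theory Num.Theory.

Set Implicit Arguments.
Unset Strict Implicit.
Unset Printing Implicit Defensive.

Local Open Scope classical_set_scope.
Local Open Scope ring_scope.
Local Open Scope complex_scope.

Definition upper_half_plane (R : realType) : Type :=
  {z : R[i] | 0 < complex.Im z}.

Definition cexp (R : realType) (z : R[i]) : R[i] :=
  (expR (complex.Re z) * cos (complex.Im z))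
    +i* (expR (complex.Re z) * sin (complex.Im z)).

(* q^r = e^(2 pi i r z): for fractional r this is a branch of the power chosen
   through z, not a function of q *)
Definition qpow (R : realType) (r : R) (z : R[i]) : R[i] :=
  cexp ((0 +i* (2 * pi * r)) * z).

Definition eta (R : realType) (z : R[i]) : R[i] :=
  qpow (24%:R^-1) z *
  limn ((fun n => \prod_(1 <= m < n.+1) (1 - qpow m%:R z))
          : nat -> (R[i] : numFieldType)).

(* The exponents of prod_d eta_d^(X_d): a finitely supported family of
   integers, indexed by the d in nat; the positivity of the d with X_d <> 0 is
   required in [expands] *)
Definition exponents := {fsfun nat -> int with 0}.

Definition eta_prod (R : realType) (X : exponents)
    (z : upper_half_plane R) : R[i] :=
  \prod_(d <- finsupp X) eta (d%:R * val z) ^ X d.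

Definition expands (R : realType) (f : upper_half_plane R -> R[i])
    (X : exponents) : Prop :=
  X 0%N = 0 /\ forall z, f z = eta_prod X z.

Definition exp_level (X : exponents) : nat :=
  \big[lcmn/1%N]_(d <- finsupp X) d.

Definition exp_weight (X : exponents) : rat :=
  (\sum_(d <- finsupp X) X d)%:~R / 2.

(* Order at a cusp a/t of Gamma_0(M), where t divides M and gcd(a, t) = 1, of
   an eta quotient whose level divides M; it does not depend on a *)
Definition cusp_order (M : nat) (X : exponents) (t : nat) : rat :=
  24%:R^-1 *
  \sum_(d <- divisors M)
    (M * gcdn d t ^ 2)%:R / (d * gcdn (t ^ 2) M)%:R * (X d)%:~R.

(* The exponents of an eta quotient are unique, so in each of the following
   definitions "exists X, expands f X /\ ..." speaks about the expansion
   of f *)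
Section EtaQuotients.
Variable R : realType.
Implicit Types f g h : upper_half_plane R -> R[i].

Definition eta_quotient f : Prop := exists X, expands f X.

Definition has_level f (N : nat) : Prop :=
  exists2 X, expands f X & exp_level X = N.

Definition has_weight f (w : rat) : Prop :=
  exists2 X, expands f X & exp_weight X = w.

Definition holomorphic_eta_quotient f : Prop :=
  exists2 X, expands f X &
    forall t : nat, (t %| exp_level X)%N -> 0 <= cusp_order (exp_level X) X t.

Definition eta_quotient_on (M : nat) f : Prop :=
  exists2 N, has_level f N & (N %| M)%N.

Definition nonconstant f : Prop := ~ exists c : R[i], forall z, f z = c.

Definition factorizable_on (M : nat) f : Prop :=
  exists g h,
    [/\ holomorphic_eta_quotient g /\ eta_quotient_on M g,
        holomorphic_eta_quotient h /\ eta_quotient_on M h,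
        nonconstant g, nonconstant h & forall z, f z = g z * h z].

Definition primitive f : Prop :=
  ~ exists h (nu : nat),
      [/\ eta_quotient h, h <> f, (0 < nu)%N &
          forall z w : upper_half_plane R,
            val w = nu%:R * val z -> f z = h w].

Definition quasi_irreducible f : Prop :=
  exists2 N, has_level f N & ~ factorizable_on N f.

Definition simple_holomorphic_eta_quotient f : Prop :=
  [/\ holomorphic_eta_quotient f, primitive f & quasi_irreducible f].

End EtaQuotients.

(* Main.v *)
Require Import Defs.
From mathcomp Require Import ring lra zify.

(* The order of prod_d eta_d^(X_d) at the cusps of denominator t has the sign of
   Y(t) = sum_d X_d / delta(t, d), where delta(t, d) = lcm(t, d) / gcd(t, d) is
   the exponential of the l^1 distance between exponent vectors.  The kernel
   1 / delta is a tensor product over the primes p of the kernels p^-|i - j|,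
   with tridiagonal inverses whose column sums are positive, and holomorphy
   means Y >= 0.

   First, sum_d |X_d| is bounded in terms of the weight alone, whatever the
   level.  Summing X over the exponents of a prime preserves Y >= 0.  If all
   primes are large compared with k, adding them one at a time shows that an
   integral X with Y >= 0 and total k is itself nonnegative: the off-diagonal
   entries of the inverse kernel contribute less than 1.  In general, with P
   large, the sums of X over the cells of given exponents at the primes >= P are
   therefore nonnegative with total k, hence at most k cells have a nonzero sum;
   in any other cell the entries of X are at most C k / P, C a product over the
   primes below P that is o(P), so they vanish.

   Second, group the support of X into clusters.  If the clusters are far apart
   compared with their diameters, integrality forces each of them to be
   holomorphic by itself, and X factorizes.  So the support of a
   quasi-irreducible X, which has boundedly many points, is a single cluster of
   bounded diameter, and if X is primitive this diameter bounds the level. *)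

Import Order.TTheory GRing.Theory Num.Theory.

Set Implicit Arguments.
Unset Strict Implicit.
Unset Printing Implicit Defensive.

Local Open Scope classical_set_scope.
Local Open Scope ring_scope.
Local Open Scope complex_scope.

(** * The kernel of one prime *)

Ltac nonzero := repeat (apply/andP; split); apply: lt0r_neq0; nra.

Section PrimeKernel.
Variable F : realFieldType.
Implicit Types (q s : F) (m : nat).

Definition geom_kernel q (i j : nat) : F := q ^+ ((i - j) + (j - i)).

(** For [s = -1] this is the inverse of [geom_kernel q] on the indices 0, ..., m + 1; for [s = 1] it
    is the matrix of absolute values. Writing the size as m + 2 keeps the two end rows distinct. *)
Definition tridiag q s m (j i : nat) : F :=
  (if i == j then (if (j == 0)%N || (j == m.+1)%N then 1 else 1 + q ^+ 2)
   else if (i.+1 == j)%N || (i == j.+1)%N then s * q else 0) / (1 - q ^+ 2).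

Lemma tridiagC q s m j i : tridiag q s m j i = tridiag q s m i j.
Proof.
rewrite /tridiag [i == j]eq_sym; have [->//|ne] := eqVneq j i.
by rewrite [i.+1 == j]eq_sym [i == j.+1]eq_sym orbC.
Qed.

Lemma sum_tridiag q s m (j : nat) (f : nat -> F) : (j < m.+2)%N ->
  \sum_(i < m.+2) tridiag q s m j i * f i =
  ((if (j == 0)%N || (j == m.+1)%N then 1 else 1 + q ^+ 2) * f j
   + s * q * ((if (j == 0)%N then 0 else f j.-1) +
              (if (j == m.+1)%N then 0 else f j.+1))) / (1 - q ^+ 2).
Proof.
move=> jm; rewrite mulrDl [in RHS]mulrDr mulrDl.
set D := if _ || _ then _ else _.
have sel (a : nat) (g : F) : \sum_(i < m.+2) (if (i == a :> nat) then g * f i else 0)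
    = if (a < m.+2)%N then g * f a else 0.
  by rewrite -big_mkcond /= (big_ord1_eq _ (fun i => g * f i)).
have e1 : \sum_(i < m.+2) tridiag q s m j i * f i =
   \sum_(i < m.+2) (if (i == j :> nat) then (D / (1 - q ^+ 2)) * f i else 0)
   + \sum_(i < m.+2) (if (i.+1 == j :> nat) then (s * q / (1 - q ^+ 2)) * f i else 0)
   + \sum_(i < m.+2) (if (i == j.+1 :> nat) then (s * q / (1 - q ^+ 2)) * f i else 0).
  rewrite -!big_split /=; apply: eq_bigr => i _; rewrite /tridiag -/D.
  have [->|ne] := eqVneq (i : nat) j.
    have -> : (j.+1 == j) = false by lia.
    have -> : (j == j.+1) = false by lia.
    by rewrite !addr0.
  have [e|ne2] := eqVneq i.+1 j => /=.
    have -> : ((i : nat) == j.+1) = false by lia.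
    by rewrite add0r addr0.
  by case: ifP => _; rewrite ?add0r ?addr0 ?mul0r.
rewrite e1 !sel jm -addrA; congr (_ + (_ + _)).
- by rewrite mulrAC.
- case: j jm D e1 => [|j] jm D e1.
    by rewrite big1 ?mulr0 ?mul0r// => i _.
  have -> : \sum_(i < m.+2) (if i.+1 == j.+1 then s * q / (1 - q ^+ 2) * f i else 0)
    = \sum_(i < m.+2) (if i == j :> nat then s * q / (1 - q ^+ 2) * f i else 0).
    by apply: eq_bigr => i _; rewrite eqSS.
  by rewrite sel (ltnW jm) /= mulrAC.
- rewrite ltnS; case: ifPn => h.
    have -> : (j == m.+1) = false by lia.
    by rewrite mulrAC.
  have -> : (j == m.+1) by lia.
  by rewrite mulr0 mul0r.
Qed.

(** Column sums of the inverse kernel; at interior points they stay positive because 1 + q^2 - 2 q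
    is a square. *)
Definition tri_weight q m (i : nat) : F :=
  if (i == 0)%N || (i == m.+1)%N then 1 / (1 + q) else (1 - q) / (1 + q).

Lemma one_sub_sqr_gt0 q : 0 < q -> q <= 1 / 2 -> 0 < 1 - q ^+ 2.
Proof. by move=> q0 q1; nra. Qed.

Lemma tri_weight_gt0 q m i (q0 : 0 < q) (q1 : q <= 1 / 2) : 0 < tri_weight q m i.
Proof.
have Q0 := one_sub_sqr_gt0 q0 q1; have N0 : 0 < (1 - q) ^+ 2 by apply: exprn_gt0; lra.
by rewrite /tri_weight; case: ifP => _; apply: divr_gt0; lra. Qed.

Lemma tridiag_norm q m j i (q0 : 0 < q) (q1 : q <= 1 / 2) : `|tridiag q (-1) m j i| = tridiag q 1 m j i.
Proof.
have Q0 := one_sub_sqr_gt0 q0 q1; have N0 : 0 < (1 - q) ^+ 2 by apply: exprn_gt0; lra.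
rewrite /tridiag normrM [X in _ * X]ger0_norm; last by rewrite invr_ge0 ltW.
congr (_ / _); case: ifP => _; first by case: ifP => _; rewrite ger0_norm //; nra.
by case: ifP => _; rewrite ?normr0 // mulN1r normrN mul1r ger0_norm // ltW.
Qed.

Lemma sum_tri_weight q m i (q0 : 0 < q) (q1 : q <= 1 / 2) : (i < m.+2)%N ->
  \sum_(j < m.+2) tridiag q (-1) m j i = tri_weight q m i.
Proof.
have Q0 := one_sub_sqr_gt0 q0 q1; have N0 : 0 < (1 - q) ^+ 2 by apply: exprn_gt0; lra.
move=> im.
under eq_bigr do rewrite tridiagC -[tridiag _ _ _ _ _]mulr1.
rewrite (@sum_tridiag _ _ _ _ (fun=> 1)) // /tri_weight.
case: i im => [|i] im /=.
  by field; nonzero.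
case: eqP => _ /=; field; nonzero.
Qed.

Lemma geom_kernelxx q j : geom_kernel q j j = 1.
Proof. by rewrite /geom_kernel subnn. Qed.

Lemma geom_kernel_gt0 q i j : 0 < q -> 0 < geom_kernel q i j.
Proof. by move=> q0; exact: exprn_gt0. Qed.

(** Off the diagonal everything cancels by the recurrence (1 + q^2) q^e = q (q^(e-1) + q^(e+1)), or
    by q^e = q q^(e-1) in an end row. *)
Lemma tridiag_geom q m j l (q0 : 0 < q) (q1 : q <= 1 / 2) : (j < m.+2)%N -> (l < m.+2)%N ->
  \sum_(i < m.+2) tridiag q (-1) m j i * geom_kernel q i l = (j == l)%:R.
Proof.
have Q0 := one_sub_sqr_gt0 q0 q1; have N0 : 0 < (1 - q) ^+ 2 by apply: exprn_gt0; lra.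
move=> jm lm; rewrite (@sum_tridiag _ _ _ _ (fun i => geom_kernel q i l)) //.
have Qn : 1 - q ^+ 2 != 0 by apply: lt0r_neq0; exact: Q0.
rewrite /geom_kernel; have [->|ne] := eqVneq j l.
  case: l lm => [|l] lm /=.
    by rewrite !sub0n !subn0 /=; field; nonzero.
  have -> : (l - l.+1 + (l.+1 - l) = 1)%N by lia.
  have -> : (l.+2 - l.+1 + (l.+1 - l.+2) = 1)%N by lia.
  by rewrite subnn; case: eqP => _ /=; field; nonzero.
have [lj|lj] := ltnP l j.
  have [e ej] : exists e, j = (l + e.+1)%N by exists (j - l).-1; lia.
  subst j; have -> : (l + e.+1 == 0)%N = false by lia.
  have -> : ((l + e.+1) - l + (l - (l + e.+1)) = e.+1)%N by lia.
  have -> : ((l + e.+1).-1 - l + (l - (l + e.+1).-1) = e)%N by lia.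
  have -> : ((l + e.+1).+1 - l + (l - (l + e.+1).+1) = e.+2)%N by lia.
  by rewrite !exprS /=; case: eqP => _; field; nonzero.
have [e ej] : exists e, l = (j + e.+1)%N by exists (l - j).-1; lia.
subst l; have -> : (j == m.+1)%N = false by lia.
have -> : (j - (j + e.+1) + (j + e.+1 - j) = e.+1)%N by lia.
have -> : (j.+1 - (j + e.+1) + (j + e.+1 - j.+1) = e)%N by lia.
rewrite orbF; have [j0|j0] := eqVneq j 0%N; rewrite /=.
  by rewrite !exprS; field; nonzero.
have -> : (j.-1 - (j + e.+1) + (j + e.+1 - j.-1) = e.+2)%N by lia.
by rewrite !exprS; field; nonzero.
Qed.

(** Relative to [tri_weight], [diag_growth] bounds single entries of the inverse kernel and
    [norm_growth] its absolute column sums; [peak_growth] bounds the diagonal of the absolute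
    inverse times the kernel. Only the last is 1 + O(q^2), so its product over all primes stays
    bounded. *)
Definition diag_growth (q : F) := (1 + q ^+ 2) / (1 - q) ^+ 2.
Definition norm_growth (q : F) := ((1 + q) / (1 - q)) ^+ 2.
Definition peak_growth (q : F) := (1 + 3 * q ^+ 2) / (1 - q ^+ 2).

Lemma tridiag_diag_ge1 q m j (q0 : 0 < q) (q1 : q <= 1 / 2) : 1 <= tridiag q (-1) m j j.
Proof.
have Q0 := one_sub_sqr_gt0 q0 q1; have N0 : 0 < (1 - q) ^+ 2 by apply: exprn_gt0; lra.
by rewrite /tridiag eqxx ler_pdivlMr //; case: ifP => _; nra. Qed.

(** Off the diagonal the entries are O(q) times the weight, a gain over [tridiag_le] for large
    primes. *)
Lemma tridiag_offdiag_le q m j i (q0 : 0 < q) (q1 : q <= 1 / 2) : j != i ->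
  tridiag q 1 m j i <= q / (1 - q) ^+ 2 * tri_weight q m i.
Proof.
have Q0 := one_sub_sqr_gt0 q0 q1; have N0 : 0 < (1 - q) ^+ 2 by apply: exprn_gt0; lra.
move=> ne; rewrite /tridiag /tri_weight eq_sym (negPf ne) mul1r.
have [h1 h2] : 0 < 1 + q /\ 0 < 1 - q by split; lra.
have -> : 1 - q ^+ 2 = (1 - q) * (1 + q) by ring.
have W : q / ((1 - q) * (1 + q)) <= q / (1 - q) ^+ 2 * ((1 - q) / (1 + q)).
  by rewrite le_eqVlt; apply/orP; left; apply/eqP; field; nonzero.
have W2 : q / (1 - q) ^+ 2 * ((1 - q) / (1 + q)) <= q / (1 - q) ^+ 2 * (1 / (1 + q)).
  apply: ler_wpM2l; first by apply: divr_ge0; nra.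
  by rewrite ler_wpM2r ?invr_ge0; lra.
have W3 : 0 <= q / (1 - q) ^+ 2 * ((1 - q) / (1 + q)).
  by apply: mulr_ge0; apply: divr_ge0; nra.
by case: ifP => _; case: ifP => _; rewrite ?mul0r; lra.
Qed.

Lemma tridiag_le q m j i (q0 : 0 < q) (q1 : q <= 1 / 2) :
  tridiag q 1 m j i <= diag_growth q * tri_weight q m i.
Proof.
have [h1 h2] : 0 < 1 + q /\ 0 < 1 - q by split; lra.
have N0 : 0 < (1 - q) ^+ 2 by apply: exprn_gt0.
have s0 := sqr_ge0 q.
have [->|ne] := eqVneq j i; last first.
  apply: (le_trans (tridiag_offdiag_le _ q0 q1 ne)).
  apply: ler_wpM2r; first exact/ltW/(tri_weight_gt0 _ _ q0 q1).
  by rewrite /diag_growth ler_wpM2r ?invr_ge0 ?(ltW N0) //; lra.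
rewrite /tridiag /tri_weight /diag_growth eqxx.
have -> : 1 - q ^+ 2 = (1 - q) * (1 + q) by ring.
case: ifP => _; last first.
  by rewrite le_eqVlt; apply/orP; left; apply/eqP; field; nonzero.
have -> : (1 + q ^+ 2) / (1 - q) ^+ 2 * (1 / (1 + q)) =
   1 / ((1 - q) * (1 + q)) * ((1 + q ^+ 2) / (1 - q)).
  by field; nonzero.
rewrite ler_peMr //; last by rewrite ler_pdivlMr //; lra.
by rewrite divr_ge0 // mulr_ge0 // ltW.
Qed.

Lemma sum_tridiag_le q m i (q0 : 0 < q) (q1 : q <= 1 / 2) : (i < m.+2)%N ->
  \sum_(j < m.+2) tridiag q 1 m j i <= norm_growth q * tri_weight q m i.
Proof.
move=> im; under eq_bigr do rewrite tridiagC -[tridiag _ _ _ _ _]mulr1.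
rewrite (@sum_tridiag _ _ _ _ (fun=> 1)) // /tri_weight /norm_growth.
have [h1 h2] : 0 < 1 + q /\ 0 < 1 - q by split; lra.
have -> : 1 - q ^+ 2 = (1 - q) * (1 + q) by ring.
have E : (1 + q ^+ 2 + 2 * q) / ((1 - q) * (1 + q)) =
  ((1 + q) / (1 - q)) ^+ 2 * ((1 - q) / (1 + q)).
  by field; nonzero.
have E2 : (1 + q) / ((1 - q) * (1 + q)) <= ((1 + q) / (1 - q)) ^+ 2 * (1 / (1 + q)).
  have -> : ((1 + q) / (1 - q)) ^+ 2 * (1 / (1 + q)) =
     (1 + q) / ((1 - q) * (1 + q)) * ((1 + q) / (1 - q)).
    by field; nonzero.
  rewrite ler_peMr //; last by rewrite ler_pdivlMr //; lra.
  by rewrite divr_ge0 ?mulr_ge0 ?ltW.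
have -> : forall a b : F, 1 * q * (a + b) = q * (a + b) by move=> a b; ring.
case: i im => [|i] im /=; last case: eqP => _ /=.
- by rewrite !mulr1 add0r mulr1.
- by rewrite !mulr1 addr0 mulr1.
- by rewrite mulr1 -E (_ : q * (1 + 1) = 2 * q) //; ring.
Qed.

(** At distance e >= 1 from the diagonal the numerator is at most 2 q^e (1 + q^2), which yields the
    factor 2 q. *)
Lemma tridiag_geom_le q m j l (q0 : 0 < q) (q1 : q <= 1 / 2) : (j < m.+2)%N -> (l < m.+2)%N ->
  \sum_(i < m.+2) tridiag q 1 m j i * geom_kernel q i l <=
  (if j == l then 1 else 2 * q) * peak_growth q.
Proof.
have Q0 := one_sub_sqr_gt0 q0 q1; have N0 : 0 < (1 - q) ^+ 2 by apply: exprn_gt0; lra.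
move=> jm lm; rewrite (@sum_tridiag _ _ _ _ (fun i => geom_kernel q i l)) //.
rewrite /peak_growth [leRHS]mulrA; apply: ler_wpM2r; first by rewrite invr_ge0 ltW.
rewrite /geom_kernel; have [->|ne] := eqVneq j l.
  rewrite subnn expr0.
  case: l lm => [|l] lm /=.
    by rewrite !sub0n !subn0 /= expr1; nra.
  have -> : (l - l.+1 + (l.+1 - l) = 1)%N by lia.
  have -> : (l.+2 - l.+1 + (l.+1 - l.+2) = 1)%N by lia.
  by case: eqP => _ /=; rewrite expr1; nra.
have qe e : 0 < q ^+ e <= 1.
  by rewrite exprn_gt0 //= exprn_ile1 //; lra.
have [lj|lj] := ltnP l j.
  have [e ej] : exists e, j = (l + e.+1)%N by exists (j - l).-1; lia.
  subst j; have -> : (l + e.+1 == 0)%N = false by lia.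
  have -> : ((l + e.+1) - l + (l - (l + e.+1)) = e.+1)%N by lia.
  have -> : ((l + e.+1).-1 - l + (l - (l + e.+1).-1) = e)%N by lia.
  have -> : ((l + e.+1).+1 - l + (l - (l + e.+1).+1) = e.+2)%N by lia.
  rewrite !exprS /=; have /andP[] := qe e; move: (q ^+ e) => x x0 x1.
  have qx : q * x <= q by nra.
  have q2 : 0 < q * q by nra.
  have q3 : 0 < q * (q * q) by nra.
  by case: eqP => _; nra.
have [e ej] : exists e, l = (j + e.+1)%N by exists (l - j).-1; lia.
subst l; have -> : (j == m.+1)%N = false by lia.
have -> : (j - (j + e.+1) + (j + e.+1 - j) = e.+1)%N by lia.
have -> : (j.+1 - (j + e.+1) + (j + e.+1 - j.+1) = e)%N by lia.
have /andP[x0 x1] := qe e.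
have qx : q * q ^+ e <= q by nra.
have q2 : 0 < q * q by nra.
have q3 : 0 < q * (q * q) by nra.
rewrite orbF; have [j0|j0] := eqVneq j 0%N; rewrite /=.
  by rewrite exprS; move: (q ^+ e) x0 x1 qx => x x0 x1 qx; nra.
have -> : (j.-1 - (j + e.+1) + (j + e.+1 - j.-1) = e.+2)%N by lia.
by rewrite !exprS; move: (q ^+ e) x0 x1 qx => x x0 x1 qx; nra.
Qed.

Lemma peak_growth_ge1 q (q0 : 0 < q) (q1 : q <= 1 / 2) : 1 <= peak_growth q.
Proof.
have Q0 := one_sub_sqr_gt0 q0 q1; have N0 : 0 < (1 - q) ^+ 2 by apply: exprn_gt0; lra.
by rewrite /peak_growth ler_pdivlMr; nra. Qed.
Lemma diag_growth_ge1 q (q0 : 0 < q) (q1 : q <= 1 / 2) : 1 <= diag_growth q.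
Proof.
have Q0 := one_sub_sqr_gt0 q0 q1; have N0 : 0 < (1 - q) ^+ 2 by apply: exprn_gt0; lra.
by rewrite /diag_growth ler_pdivlMr; nra. Qed.
Lemma norm_growth_ge1 q (q0 : 0 < q) (q1 : q <= 1 / 2) : 1 <= norm_growth q.
Proof.
have Q0 := one_sub_sqr_gt0 q0 q1; have N0 : 0 < (1 - q) ^+ 2 by apply: exprn_gt0; lra.
by rewrite /norm_growth expr_ge1 // ler_pdivlMr; nra. Qed.

End PrimeKernel.

(** * Tensor products of kernels *)

Section Kernels.
Variable F : realFieldType.

(** The properties of the one-prime kernel that the estimates use and that tensor products preserve;
    positivity of the weights is the crucial one. *)
Record kernel (T : finType) := Kernel {
  ker : T -> T -> F;
  ker_inv : T -> T -> F;
  ker_weight : T -> F;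
  ker_ge0 : forall t d, 0 <= ker t d;
  ker_xx : forall d, ker d d = 1;
  ker_weight_gt0 : forall t, 0 < ker_weight t;
  ker_invP : forall d e, \sum_t ker_inv d t * ker t e = (d == e)%:R;
  sum_ker_inv : forall t, \sum_d ker_inv d t = ker_weight t }.

(** If the potential of [x] is nonnegative, this matrix applied to [x] bounds |x d|: each inverse
    entry is replaced by its absolute value. *)
Definition ker_abs (T : finType) (k : kernel T) d e :=
  \sum_t `|ker_inv k d t| * ker k t e.

Definition potential (T : finType) (k : kernel T) (x : T -> F) t :=
  \sum_d ker k t d * x d.

Lemma sum_mul_pair (A B : finType) (f : A -> F) (g : B -> F) :
  \sum_(u : A * B) f u.1 * g u.2 = (\sum_a f a) * (\sum_b g b).
Proof. by rewrite big_distrlr pair_bigA. Qed.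

Lemma sum_pair (V : nmodType) (A B : finType) (f : A * B -> V) :
  \sum_u f u = \sum_a \sum_b f (a, b).
Proof. by rewrite pair_bigA; apply: eq_bigr => -[]. Qed.

Section OneKernel.
Variables (T : finType) (k : kernel T).

Lemma ker_inv_potential x d : x d = \sum_t ker_inv k d t * potential k x t.
Proof.
transitivity (\sum_e (\sum_t ker_inv k d t * ker k t e) * x e).
  under eq_bigr do rewrite ker_invP.
  rewrite (bigD1 d) //= eqxx mul1r big1 ?addr0 // => e /negPf ne.
  by rewrite eq_sym ne mul0r.
under eq_bigr do rewrite mulr_suml.
rewrite exchange_big; apply: eq_bigr => t _ /=.
by rewrite /potential mulr_sumr; apply: eq_bigr => e _; rewrite mulrA.
Qed.

(** The total is a positive combination of values of the potential, so a nonnegative potential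
    forces a nonnegative total. *)
Lemma sum_weight_potential x : \sum_t ker_weight k t * potential k x t = \sum_d x d.
Proof.
under [RHS]eq_bigr do rewrite ker_inv_potential.
rewrite exchange_big; apply: eq_bigr => t _ /=.
by rewrite -sum_ker_inv mulr_suml.
Qed.

Lemma ker_abs_ge0 d e : 0 <= ker_abs k d e.
Proof. by apply: sumr_ge0 => t _; rewrite mulr_ge0 ?ker_ge0. Qed.

Lemma sum_ker_inv_potential x d :
  \sum_t `|ker_inv k d t| * potential k x t = \sum_e ker_abs k d e * x e.
Proof.
under [RHS]eq_bigr do rewrite mulr_suml.
rewrite [RHS]exchange_big; apply: eq_bigr => t _ /=.
by rewrite /potential mulr_sumr; apply: eq_bigr => e _; rewrite mulrA.
Qed.

End OneKernel.

Section Tensor.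
Variables (A B : finType) (ka : kernel A) (kb : kernel B).

Let tker (u v : A * B) := ker ka u.1 v.1 * ker kb u.2 v.2.
Let tinv (u v : A * B) := ker_inv ka u.1 v.1 * ker_inv kb u.2 v.2.
Let tweight (u : A * B) := ker_weight ka u.1 * ker_weight kb u.2.

Let tker_ge0 u v : 0 <= tker u v. Proof. by rewrite mulr_ge0 ?ker_ge0. Qed.
Let tker_xx u : tker u u = 1. Proof. by rewrite /tker !ker_xx mulr1. Qed.
Let tweight_gt0 u : 0 < tweight u. Proof. by rewrite mulr_gt0 ?ker_weight_gt0. Qed.
Let tinvP u v : \sum_t tinv u t * tker t v = (u == v)%:R.
Proof.
under eq_bigr do rewrite /tinv /tker mulrACA.
rewrite (sum_mul_pair (fun a => ker_inv ka u.1 a * ker ka a v.1)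
                      (fun b => ker_inv kb u.2 b * ker kb b v.2)) !ker_invP.
by rewrite -natrM mulnb -xpair_eqE -!surjective_pairing.
Qed.
Let sum_tinv t : \sum_d tinv d t = tweight t.
Proof.
by rewrite (sum_mul_pair (fun a => ker_inv ka a t.1) (fun b => ker_inv kb b t.2))
  !sum_ker_inv.
Qed.

Definition tensor := Kernel tker_ge0 tker_xx tweight_gt0 tinvP sum_tinv.

Lemma ker_abs_tensor u v :
  ker_abs tensor u v = ker_abs ka u.1 v.1 * ker_abs kb u.2 v.2.
Proof.
rewrite /ker_abs -sum_mul_pair; apply: eq_bigr => t _ /=.
by rewrite /tinv /tker normrM mulrACA.
Qed.

Definition marginal (x : A * B -> F) b := \sum_a x (a, b).

(** The weights of the first factor integrate its coordinate out, so the marginal inherits a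
    nonnegative potential. *)
Lemma potential_marginal x t :
  \sum_s ker_weight ka s * potential tensor x (s, t) = potential kb (marginal x) t.
Proof.
transitivity (\sum_s ker_weight ka s *
    potential ka (fun a => \sum_b ker kb t b * x (a, b)) s).
  apply: eq_bigr => s _; congr (_ * _); rewrite /potential.
  rewrite sum_pair /=.
  apply: eq_bigr => a _; rewrite mulr_sumr; apply: eq_bigr => b _.
  by rewrite /tker mulrA.
rewrite sum_weight_potential exchange_big; apply: eq_bigr => b _ /=.
by rewrite mulr_sumr.
Qed.

(** Once [f] is dominated by the weight, the sum over the first coordinate collapses to the
    potential of the marginal. *)
Lemma sum_tensor_bound (f : A -> F) (g : B -> F) x (C : F) :
    (forall b, 0 <= g b) -> (forall a, f a <= C * ker_weight ka a) ->
    (forall u, 0 <= potential tensor x u) ->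
  \sum_u f u.1 * g u.2 * potential tensor x u <=
    C * \sum_t g t * potential kb (marginal x) t.
Proof.
move=> g0 fC Y0.
under [X in C * X]eq_bigr do rewrite -potential_marginal mulr_sumr.
rewrite exchange_big mulr_sumr sum_pair.
apply: ler_sum => a _ /=; rewrite mulr_sumr; apply: ler_sum => b _.
have -> : forall z, C * (g b * (ker_weight ka a * z)) = C * ker_weight ka a * g b * z.
  by move=> z; ring.
by rewrite ler_wpM2r // ler_wpM2r.
Qed.

Lemma tensor_marginal_bound x (C : F) e a :
    (forall s, `|ker_inv ka e s| <= C * ker_weight ka s) ->
    (forall u, 0 <= potential tensor x u) ->
  `|x (e, a)| <= C * \sum_b ker_abs kb a b * marginal x b.
Proof.
move=> hC Y0; rewrite -sum_ker_inv_potential.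
have := @sum_tensor_bound _ (fun t => `|ker_inv kb a t|) x _ _ hC Y0.
move/(_ (fun=> normr_ge0 _)); apply: le_trans.
rewrite [x (e, a)](ker_inv_potential tensor); apply: le_trans (ler_norm_sum _ _ _) _.
by apply: ler_sum => u _; rewrite !normrM (ger0_norm (Y0 u)).
Qed.

(** Summing over [e] before comparing with the weight bounds a whole cell at once, without counting
    its points. *)
Lemma tensor_marginal_norm x (C : F) a :
    (forall s, \sum_e `|ker_inv ka e s| <= C * ker_weight ka s) ->
    (forall u, 0 <= potential tensor x u) ->
  \sum_e `|x (e, a)| <= C * \sum_b ker_abs kb a b * marginal x b.
Proof.
move=> hC Y0; rewrite -sum_ker_inv_potential.
have := @sum_tensor_bound (fun s => \sum_e `|ker_inv ka e s|)
  (fun t => `|ker_inv kb a t|) x _ _ hC Y0.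
move/(_ (fun=> normr_ge0 _)); apply: le_trans.
under [leRHS]eq_bigr do rewrite !mulr_suml.
rewrite exchange_big; apply: ler_sum => e _.
rewrite [x (e, a)](ker_inv_potential tensor); apply: le_trans (ler_norm_sum _ _ _) _.
by apply: ler_sum => u _; rewrite !normrM (ger0_norm (Y0 u)).
Qed.

(* All entries of the inverse kernel but the diagonal one can contribute
   negatively; they are controlled by the potential of the marginal. *)
Lemma tensor_lower_bound x (g h D eps : F) j d :
    (forall i, `|ker_inv ka j i| <= g * ker_weight ka i) ->
    (forall i, i != j -> `|ker_inv ka j i| <= h * ker_weight ka i) ->
    0 <= ker_inv ka j j -> 0 <= ker_inv kb d d -> 0 <= g -> 0 <= h ->
    (forall b, \sum_(t | t != d) `|ker_inv kb d t| * ker kb t b <= eps) ->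
    (forall b, ker_inv kb d d * ker kb d b <= D) ->
    (forall b, 0 <= marginal x b) ->
    (forall u, 0 <= potential tensor x u) ->
  - x (j, d) <= (g * eps + h * D) * \sum_b marginal x b.
Proof.
move=> hg hh j0 d0 g0 h0 heps hD m0 Y0.
set c := ker_weight ka; set Y := potential tensor x.
(* In the slice t = d the entry i = j has the harmless sign, so only off-diagonal entries count and
   the constant [h] applies; elsewhere [g] does. *)
set G := fun t => if t == d then h * ker_inv kb d d else g * `|ker_inv kb d t|.
have c0 i : 0 <= c i by exact/ltW/ker_weight_gt0.
have step1 : - x (j, d) <= \sum_u c u.1 * G u.2 * Y u.
  rewrite [x (j, d)](ker_inv_potential tensor) -sumrN; apply: ler_sum => -[i t] _ /=.
  rewrite /tinv /= -mulNr ler_wpM2r // /G; case: eqP => [->|_].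
    have [->|/hh hi] := eqVneq i j.
      apply: (@le_trans _ _ 0); first by rewrite oppr_le0 mulr_ge0.
      by rewrite mulr_ge0 // mulr_ge0.
    rewrite -mulNr mulrA ler_wpM2r // [c i * h]mulrC.
    by apply: le_trans hi; rewrite -normrN ler_norm.
  apply: le_trans (ler_norm _) _; rewrite normrN normrM mulrA ler_wpM2r //.
  by rewrite [c i * g]mulrC.
apply: le_trans step1 _.
have step2 : \sum_u c u.1 * G u.2 * Y u = \sum_t G t * potential kb (marginal x) t.
  rewrite sum_pair exchange_big /=.
  apply: eq_bigr => t _; rewrite -potential_marginal mulr_sumr.
  by apply: eq_bigr => s _; rewrite mulrCA mulrA.
rewrite step2 /potential; under eq_bigr do rewrite mulr_sumr.
rewrite exchange_big mulr_sumr /=; apply: ler_sum => b _.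
under eq_bigr do rewrite mulrA; rewrite -mulr_suml ler_wpM2r //.
rewrite (bigD1 d) //= addrC; apply: lerD.
  apply: le_trans (ler_wpM2l g0 (heps b)); rewrite mulr_sumr.
  by apply: ler_sum => t /negPf td; rewrite /G td mulrA.
by rewrite /G eqxx -mulrA ler_wpM2l.
Qed.

End Tensor.
End Kernels.

(** * Kernels on boxes of exponent vectors *)

Section BoxKernel.
Variables (F : realFieldType) (m : nat).

Section PrimePower.
Variable q : F.
Hypotheses (q0 : 0 < q) (q1 : q <= 1 / 2).

Let K (t d : 'I_m.+2) := geom_kernel q t d.
Let L (t d : 'I_m.+2) := tridiag q (-1) m t d.
Let w (t : 'I_m.+2) := tri_weight q m t.

Let K_ge0 t d : 0 <= K t d. Proof. exact/ltW/geom_kernel_gt0. Qed.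
Let K_xx d : K d d = 1. Proof. exact: geom_kernelxx. Qed.
Let w_gt0 t : 0 < w t. Proof. exact: tri_weight_gt0. Qed.
Let L_inv d e : \sum_t L d t * K t e = (d == e)%:R.
Proof. by rewrite /L /K tridiag_geom. Qed.
Let sum_L t : \sum_d L d t = w t. Proof. exact: sum_tri_weight. Qed.

Definition prime_kernel := Kernel K_ge0 K_xx w_gt0 L_inv sum_L.

End PrimePower.

Let K1 (t d : unit) : F := 1.
Let K1_ge0 t d : 0 <= K1 t d. Proof. exact: ler01. Qed.
Let K1_xx d : K1 d d = 1. Proof. by []. Qed.
Let w1_gt0 (t : unit) : 0 < 1 :> F. Proof. exact: ltr01. Qed.
Let L1_inv d e : \sum_t K1 d t * K1 t e = (d == e)%:R.
Proof. by rewrite (big_pred1 tt) => [|[]//]; rewrite /K1 mulr1; case: d; case: e. Qed.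
Let sum_L1 t : \sum_d K1 d t = 1.
Proof. by rewrite (big_pred1 tt) // => -[]. Qed.

Definition unit_kernel := Kernel K1_ge0 K1_xx w1_gt0 L1_inv sum_L1.

(* The truncation at 2 makes this a legal ratio for every p; it is only used
   for primes. *)
Definition ratio (p : nat) : F := (maxn p 2)%:R^-1.

Lemma ratio_gt0 p : 0 < ratio p.
Proof. by rewrite invr_gt0 ltr0n; lia. Qed.

Lemma ratio_le p (P : nat) : (2 <= P)%N -> (P <= p)%N -> ratio p <= P%:R^-1.
Proof.
by move=> P2 Pp; rewrite lef_pV2 ?ler_nat ?posrE ?ltr0n; lia.
Qed.

Lemma ratio_le_half p : ratio p <= 1 / 2.
Proof. by rewrite div1r lef_pV2 ?ler_nat ?posrE ?ltr0n; lia. Qed.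

(** Exponent vectors with entries 0, ..., m + 1 at the listed primes, nested as pairs to match the
    iterated [tensor]. *)
Fixpoint box (ps : seq nat) : finType :=
  if ps is _ :: ps' then ('I_m.+2 * box ps')%type : finType else unit : finType.

Definition coord_kernel p := prime_kernel (ratio_gt0 p) (ratio_le_half p).

Fixpoint box_kernel (ps : seq nat) : kernel F (box ps) :=
  if ps is p :: ps' then tensor (coord_kernel p) (box_kernel ps') else unit_kernel.

Lemma box_inv_le ps d t : `|ker_inv (box_kernel ps) d t| <=
  (\prod_(p <- ps) diag_growth (ratio p)) * ker_weight (box_kernel ps) t.
Proof.
elim: ps d t => [|p ps IH] /=; first by move=> ? ?; rewrite big_nil mulr1 normr1.
move=> -[j d] [i t]; rewrite big_cons /= normrM mulrACA; apply: ler_pM => //.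
by rewrite tridiag_norm ?ratio_gt0 ?ratio_le_half // tridiag_le ?ratio_gt0 ?ratio_le_half.
Qed.

Lemma box_inv_norm ps t : \sum_d `|ker_inv (box_kernel ps) d t| <=
  (\prod_(p <- ps) norm_growth (ratio p)) * ker_weight (box_kernel ps) t.
Proof.
elim: ps t => [|p ps IH] /=.
  by move=> ?; rewrite big_nil mulr1 (big_pred1 tt) ?normr1 // => -[].
move=> -[i t]; rewrite big_cons mulrACA.
under eq_bigr do rewrite normrM.
rewrite (sum_mul_pair (fun a : 'I_m.+2 => `|tridiag (ratio p) (-1) m a i|)
           (fun b => `|ker_inv (box_kernel ps) b t|)).
apply: ler_pM => //; try exact: sumr_ge0.
under eq_bigr do rewrite tridiag_norm ?ratio_gt0 ?ratio_le_half //.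
by rewrite sum_tridiag_le ?ratio_gt0 ?ratio_le_half.
Qed.

Lemma box_inv_ge1 ps d : 1 <= ker_inv (box_kernel ps) d d.
Proof.
elim: ps d => [//|p ps IH] [j d] /=; rewrite -[leLHS]mulr1.
by apply: ler_pM => //; rewrite tridiag_diag_ge1 ?ratio_gt0 ?ratio_le_half.
Qed.

Definition box_peak ps := \prod_(p <- ps) peak_growth (ratio p).

Lemma box_peak_ge1 ps : 1 <= box_peak ps.
Proof.
rewrite /box_peak; elim: ps => [|p ps IH]; rewrite ?big_nil ?big_cons //.
by rewrite -[leLHS]mulr1 ler_pM // peak_growth_ge1 ?ratio_gt0 ?ratio_le_half.
Qed.

Lemma coord_abs_le p (j l : 'I_m.+2) :
  ker_abs (coord_kernel p) j l <=
  (if j == l then 1 else 2 * ratio p) * peak_growth (ratio p).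
Proof.
rewrite /ker_abs.
under eq_bigr do rewrite /= tridiag_norm ?ratio_gt0 ?ratio_le_half //.
by rewrite tridiag_geom_le ?ratio_gt0 ?ratio_le_half.
Qed.

(** Distinct vectors differ in some coordinate, which contributes 2 [ratio p] <= 2 / P besides its
    peak; further differing coordinates contribute factors at most 1. *)
Lemma box_abs_le ps (P : nat) : (2 <= P)%N -> all (leq P) ps -> forall d e,
  ker_abs (box_kernel ps) d e <= (if d == e then 1 else 2 / P%:R) * box_peak ps.
Proof.
move=> P2; rewrite /box_peak; elim: ps => [_|p ps IH /= /andP[Pp /IH{}IH]].
  move=> -[] []; rewrite eqxx /ker_abs big_nil mul1r (big_pred1 tt) ?normr1 ?mulr1 //.
move=> [j d] [l e]; rewrite ker_abs_tensor big_cons /= xpair_eqE.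
have r0 := ratio_gt0 p; have r1 := ratio_le_half p.
have pg0 := le_trans ler01 (peak_growth_ge1 r0 r1).
have bp0 := le_trans ler01 (box_peak_ge1 ps).
have h1 : ker_abs (coord_kernel p) j l <= (if j == l then 1 else 2 / P%:R) * peak_growth (ratio p).
  apply: le_trans (coord_abs_le p j l) _; rewrite ler_wpM2r //.
  by case: ifP => // _; rewrite ler_wpM2l // ratio_le.
have P0 : 2 / P%:R <= 1 :> F by rewrite ler_pdivrMr ?ltr0n ?mul1r ?ler_nat; lia.
have P00 : 0 <= 2 / P%:R :> F by rewrite divr_ge0.
apply: le_trans (ler_pM (ker_abs_ge0 _ _ _) (ker_abs_ge0 _ _ _) h1 (IH d e)) _.
rewrite mulrACA; apply: ler_wpM2r; first exact: mulr_ge0.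
case: eqP => _; case: eqP => _ /=; rewrite ?mul1r ?mulr1 //.
by rewrite ler_piMr.
Qed.

End BoxKernel.

(** * Large primes *)

Section LargePrimes.
Variables (F : realFieldType) (m : nat).
Implicit Types (ps qs : seq nat) (P k : nat).

(* The bound x / (x - 5) makes the product over increasing primes telescope. *)
Lemma box_peak_le ps P : (10 <= P)%N -> sorted ltn ps -> all (leq P) ps ->
  box_peak F ps <= P%:R / (P%:R - 5).
Proof.
elim: ps P => [|p ps IH] P P10 /=.
  have : 10 <= P%:R :> F by rewrite ler_nat.
  by rewrite /box_peak big_nil => h _ _; rewrite ler_pdivlMr; lra.
move=> sp /andP[Pp _]; rewrite /box_peak big_cons.
have p10 : 10 <= p%:R :> F by rewrite ler_nat (leq_trans P10).
have P10' : 10 <= P%:R :> F by rewrite ler_nat.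
have Pp' : P%:R <= p%:R :> F by rewrite ler_nat.
(* The list increases, so the remaining entries are at least p + 1 and the induction hypothesis
   applies with p + 1 for [P]. *)
have h : box_peak F ps <= p.+1%:R / (p.+1%:R - 5).
  by apply: IH; [lia|exact: path_sorted sp|exact: order_path_min ltn_trans sp].
have r0 := ratio_gt0 F p; have r1 := ratio_le_half F p.
apply: le_trans (ler_wpM2l (le_trans ler01 (peak_growth_ge1 r0 r1)) h) _.
have -> : ratio F p = p%:R^-1 by rewrite /ratio (maxn_idPl _) //; lia.
apply: (@le_trans _ _ (p%:R / (p%:R - 5))); last first.
  move: (p%:R : F) (P%:R : F) p10 P10' Pp' => x y x10 y10 yx.
  rewrite ler_pdivrMr; last lra.
  rewrite mulrAC ler_pdivlMr; last lra.
  have -> : y * (x - 5) = x * (y - 5) + 5 * (x - y) by ring.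
  lra.
rewrite -natr1; move: (p%:R : F) p10 => x p10.
have -> : peak_growth x^-1 * ((x + 1) / (x + 1 - 5)) = (x ^+ 2 + 3) / ((x - 1) * (x - 4)).
  by rewrite /peak_growth; field; nonzero.
have x1 : 0 < x - 1 by lra.
have x4 : 0 < x - 4 by lra.
have x5 : 0 < x - 5 by lra.
rewrite ler_pdivrMr ?mulr_gt0 // mulrAC ler_pdivlMr //.
have -> : x * ((x - 1) * (x - 4)) = (x ^+ 2 + 3) * (x - 5) + (x + 15) by ring.
lra.
Qed.

Lemma box_peak_le1 ps P : (10 <= P)%N -> sorted ltn ps -> all (leq P) ps ->
  box_peak F ps <= 1 + 10 / P%:R.
Proof.
move=> P10 sp ap; apply: le_trans (box_peak_le P10 sp ap) _.
have h : 10 <= P%:R :> F by rewrite ler_nat.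
have e : 10 / P%:R * P%:R = 10 :> F by rewrite divfK //; lra.
rewrite ler_pdivrMr; last lra.
move: (10 / P%:R) e => y e; nra.
Qed.

Lemma box_peak_le2 ps P : (10 <= P)%N -> sorted ltn ps -> all (leq P) ps ->
  box_peak F ps <= 2.
Proof.
move=> P10 sp ap; apply: le_trans (box_peak_le1 P10 sp ap) _.
have h : 10 <= P%:R :> F by rewrite ler_nat.
have : 10 / P%:R <= 1 :> F by rewrite ler_pdivrMr; lra.
lra.
Qed.

Lemma diag_growth_le2 (q : F) : 0 < q -> q <= 10^-1 -> diag_growth q <= 2.
Proof.
move=> q0 q1; rewrite /diag_growth ler_pdivrMr; last by apply: exprn_gt0; lra.
by rewrite (_ : (1 - q) ^+ 2 = 1 - 2 * q + q ^+ 2); [have := sqr_ge0 q; lra|ring].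
Qed.

Lemma offdiag_growth_le2 (q : F) : 0 < q -> q <= 10^-1 -> q / (1 - q) ^+ 2 <= 2 * q.
Proof.
move=> q0 q1; rewrite ler_pdivrMr; last by apply: exprn_gt0; lra.
rewrite mulrAC ler_peMl ?ltW //.
by rewrite (_ : (1 - q) ^+ 2 = 1 - 2 * q + q ^+ 2); [have := sqr_ge0 q; lra|ring].
Qed.

Lemma ltr_int_gtN1 (a : int) : -1 < a%:~R :> F -> 0 <= a.
Proof. by rewrite (_ : -1 = (-1)%:~R) // ltr_int; lia. Qed.

Lemma int_norm_lt1 (a : int) : `|a%:~R| < 1 :> F -> a = 0.
Proof. by rewrite -intr_norm (_ : 1 = 1%:~R) // ltr_int; lia. Qed.

Lemma marginal_int (A B : finType) (X : A * B -> int) b :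
  marginal (fun u => (X u)%:~R : F) b = (\sum_a X (a, b))%:~R.
Proof. by rewrite /marginal rmorph_sum. Qed.

(** Induction on the primes: the marginal over the first prime has the same total and is nonnegative
    by induction. Then [tensor_lower_bound] puts each entry above -24 k / P > -1, and integrality
    finishes. *)
Lemma large_primes_ge0 P k qs (w : box m qs -> int) :
  (25 * k.+1 <= P)%N -> sorted ltn qs -> all (leq P) qs ->
  (forall t, 0 <= potential (box_kernel F m qs) (fun d => (w d)%:~R) t) ->
  \sum_d w d = k%:Z ->
  forall d, 0 <= w d.
Proof.
move=> kP; elim: qs w => [|p qs IH] w.
  move=> _ _ Y0 _ []; have := Y0 tt; rewrite /potential (big_pred1 tt) => [|[]//].
  by rewrite /= mul1r ler0z.
move=> sp /andP[Pp ap] Y0 wk [j d].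
have sq : sorted ltn qs by exact: path_sorted sp.
pose x := fun u : box m (p :: qs) => (w u)%:~R : F.
pose w' := fun b => \sum_a w (a, b).
have w'E b : marginal x b = (w' b)%:~R by rewrite /x marginal_int.
have w'sum : \sum_d w' d = k%:Z by rewrite /w' exchange_big -wk sum_pair.
have w'0 b : 0 <= w' b.
  apply: IH b => // t.
  have -> : potential (box_kernel F m qs) (fun b => (w' b)%:~R) t =
      potential (box_kernel F m qs) (marginal x) t.
    by apply: eq_bigr => b _; rewrite w'E.
  rewrite -(potential_marginal (coord_kernel F m p)); apply: sumr_ge0 => s _.
  by rewrite mulr_ge0 ?Y0 // ltW // ker_weight_gt0.
have P10 : (10 <= P)%N by lia.
have P10' : 10 <= P%:R :> F by rewrite ler_nat.
have Pi0 : 0 < P%:R^-1 :> F by rewrite invr_gt0; lra.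
have r0 := ratio_gt0 F p; have r1 := ratio_le_half F p.
have rP : ratio F p <= P%:R^-1 by apply: ratio_le => //; lia.
have r10 : ratio F p <= 10^-1 by apply: le_trans rP _; rewrite lef_pV2 ?posrE; lra.
have A1 := box_peak_le1 P10 sq ap; have A2 := box_peak_le2 P10 sq ap.
have B1 := @box_inv_ge1 F m qs d.
have absE b : ker_abs (box_kernel F m qs) d b = ker_inv (box_kernel F m qs) d d *
     ker (box_kernel F m qs) d b +
     \sum_(t | t != d) `|ker_inv (box_kernel F m qs) d t| * ker (box_kernel F m qs) t b.
  by rewrite /ker_abs (bigD1 d) //= ger0_norm //; lra.
have absB b : ker_abs (box_kernel F m qs) d b <= (if d == b then 1 else 2 / P%:R) * box_peak F qs.
  exact: box_abs_le (leq_trans (isT : (2 <= 10)%N) P10) ap d b.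
have P1 : 2 / P%:R <= 1 :> F by rewrite ler_pdivrMr; lra.
(* The constants are g = D = 2, h = 2 / P and eps = 10 / P, so g eps + h D = 24 / P. *)
have hb : - x (j, d) <= (2 * (10 / P%:R) + 2 / P%:R * 2) * \sum_b marginal x b.
  apply: (@tensor_lower_bound _ _ _ (coord_kernel F m p) (box_kernel F m qs)).
  - move=> i /=; rewrite tridiag_norm //; apply: le_trans (tridiag_le _ _ _ r0 r1) _.
    rewrite ler_wpM2r //; first exact/ltW/tri_weight_gt0.
    exact: diag_growth_le2.
  - move=> i ij /=; rewrite tridiag_norm //.
    apply: le_trans (tridiag_offdiag_le _ r0 r1 _) _; first by rewrite eq_sym.
    rewrite ler_wpM2r //; first exact/ltW/tri_weight_gt0.
    by apply: le_trans (offdiag_growth_le2 r0 r10) _; rewrite ler_wpM2l.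
  - exact: le_trans ler01 (tridiag_diag_ge1 _ _ r0 r1).
  - exact: le_trans ler01 B1.
  - lra.
  - lra.
  (* For b = d the diagonal term, at least 1, is subtracted from 1 + 10 / P; for b different from d
     the whole entry is at most 4 / P. *)
  - move=> b; have := absE b; have := absB b.
    case: eqP => [<-|_]; first by rewrite ker_xx; lra.
    have Kb := ker_ge0 (box_kernel F m qs) d b.
    have : 0 <= ker_inv (box_kernel F m qs) d d * ker (box_kernel F m qs) d b.
      by rewrite mulr_ge0 //; lra.
    have : 2 / P%:R * box_peak F qs <= 2 / P%:R * 2 :> F by rewrite ler_wpM2l //; lra.
    lra.
  - move=> b; have := absE b; have := absB b.
    have : 0 <= \sum_(t | t != d) `|ker_inv (box_kernel F m qs) d t| * ker (box_kernel F m qs) t b.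
      by apply: sumr_ge0 => t _; rewrite mulr_ge0 ?ker_ge0.
    have A0 := box_peak_ge1 F qs.
    case: eqP => _; first lra.
    have : 2 / P%:R * box_peak F qs <= box_peak F qs :> F by rewrite ler_piMl //; lra.
    lra.
  - by move=> b; rewrite w'E ler0z.
  - exact: Y0.
apply: ltr_int_gtN1; rewrite -[X in _ < X]/(x (j, d)).
have se : \sum_b marginal x b = k%:R.
  under eq_bigr do rewrite w'E.
  by rewrite -rmorph_sum w'sum.
move: hb; rewrite se.
have : 24 * (k%:R / P%:R) < 1 :> F.
  have k24 : (24 * k < P)%N by clear -kP; lia.
  rewrite mulrA ltr_pdivrMr; last by lra.
  by rewrite mul1r -natrM ltr_nat.
have -> : (2 * (10 / P%:R) + 2 / P%:R * 2) * k%:R = 24 * (k%:R / P%:R) :> F by ring.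
lra.
Qed.

(* The marginal on the large primes is nonnegative with total k, so it has at
   most k atoms, and the cells away from them are too small to be nonzero
   integers. *)
Lemma holomorphic_box_norm P k ps qs (X : box m ps * box m qs -> int) :
  (25 * k.+1 <= P)%N -> sorted ltn qs -> all (leq P) qs ->
  (\prod_(p <- ps) diag_growth (ratio F p)) * (4 * k%:R) < P%:R ->
  (forall t, 0 <= potential (tensor (box_kernel F m ps) (box_kernel F m qs))
                    (fun d => (X d)%:~R) t) ->
  \sum_d X d = k%:Z ->
  (\sum_d `|X d|)%:~R <= \prod_(p <- ps) norm_growth (ratio F p) * (2 * k%:R ^+ 2).
Proof.
move=> kP sq aq C0 Y0 Xk; have P10 : (10 <= P)%N by lia.
have P10' : 10 <= P%:R :> F by rewrite ler_nat.
pose x := fun u : box m ps * box m qs => (X u)%:~R : F.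
pose w := fun b => \sum_a X (a, b).
have wE b : marginal x b = (w b)%:~R by rewrite /x marginal_int.
have wk : \sum_d w d = k%:Z by rewrite /w exchange_big -Xk sum_pair.
have w0 b : 0 <= w b.
  apply: (large_primes_ge0 kP sq aq) wk b => t.
  have -> : potential (box_kernel F m qs) (fun b => (w b)%:~R) t =
      potential (box_kernel F m qs) (marginal x) t.
    by apply: eq_bigr => b _; rewrite wE.
  rewrite -(potential_marginal (box_kernel F m ps)); apply: sumr_ge0 => s _.
  by rewrite mulr_ge0 ?Y0 // ltW // ker_weight_gt0.
have A2 := box_peak_le2 P10 sq aq; have A1 := box_peak_ge1 F qs.
have sw : \sum_b marginal x b = k%:R.
  by under eq_bigr do rewrite wE; rewrite -rmorph_sum wk.
set Cs := \prod_(p <- ps) diag_growth (ratio F p) in C0 *.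
set Gs := \prod_(p <- ps) norm_growth (ratio F p).
have Cs0 : 0 <= Cs.
  apply: prodr_ge0 => p _; apply: le_trans ler01 (diag_growth_ge1 _ _).
    exact: ratio_gt0.
  exact: ratio_le_half.
have Gs0 : 0 <= Gs.
  apply: prodr_ge0 => p _; apply: le_trans ler01 (norm_growth_ge1 _ _).
    exact: ratio_gt0.
  exact: ratio_le_half.
have absB := @box_abs_le F m qs P (leq_trans (isT : (2 <= 10)%N) P10) aq.
have P1 : 2 / P%:R <= 1 :> F by rewrite ler_pdivrMr; lra.
(* In a cell of zero sum the diagonal term of the bound vanishes, which leaves [Cs] times 4 k / P,
   less than 1. *)
have zero e a : w a = 0 -> X (e, a) = 0.
  move=> wa; have := @tensor_marginal_bound _ _ _ _ _ x Cs e a (fun s => @box_inv_le F m ps e s) Y0.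
  have h : \sum_b ker_abs (box_kernel F m qs) a b * marginal x b <= 4 / P%:R * k%:R.
    rewrite -sw mulr_sumr; apply: ler_sum => b _; rewrite wE.
    have [<-|ne] := eqVneq a b; first by rewrite wa !mulr0.
    rewrite ler_wpM2r ?ler0z //; have := absB a b; rewrite (negPf ne).
    have : 2 / P%:R * box_peak F qs <= 2 / P%:R * 2 :> F.
      by rewrite ler_wpM2l // divr_ge0 //; lra.
    lra.
  move/le_trans/(_ (ler_wpM2l Cs0 h)).
  have -> : Cs * (4 / P%:R * k%:R) = Cs * (4 * k%:R) / P%:R by ring.
  have : Cs * (4 * k%:R) / P%:R < 1 by rewrite ltr_pdivrMr ?mul1r; lra.
  move=> h1 h2; have : `|x (e, a)| < 1 by exact: le_lt_trans h2 h1.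
  exact: int_norm_lt1.
(* A nonzero cell has [w a] at least 1, and multiplying by it replaces counting the cells: the [w a]
   add up to k. *)
have cell a : (\sum_e `|X (e, a)|)%:~R <= Gs * (2 * k%:R) * (w a)%:~R.
  have [wa|wa] := eqVneq (w a) 0.
    by rewrite wa mulr0 big1 // => e _; rewrite zero.
  have wa1 : 1 <= (w a)%:~R :> F by rewrite (_ : 1 = 1%:~R) // ler_int -gtz0_ge1 lt_def wa w0.
  have h := @tensor_marginal_norm _ _ _ _ _ x Gs a (fun s => @box_inv_norm F m ps s) Y0.
  have -> : (\sum_e `|X (e, a)|)%:~R = \sum_e `|x (e, a)|.
    by rewrite rmorph_sum; apply: eq_bigr => e _; rewrite /x -intr_norm.
  apply: le_trans h _; rewrite -[leLHS]mulr1; apply: ler_pM => //.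
    apply: mulr_ge0 => //; apply: sumr_ge0 => b _.
    by rewrite mulr_ge0 ?ker_abs_ge0 // wE ler0z.
  rewrite ler_wpM2l // -sw mulr_sumr; apply: ler_sum => b _.
  rewrite wE ler_wpM2r ?ler0z //; apply: le_trans (absB a b) _.
  by case: eqP => _; [lra|apply: le_trans A2; rewrite ler_piMl //; lra].
rewrite sum_pair exchange_big rmorph_sum; apply: le_trans (ler_sum _ (fun a _ => cell a)) _.
rewrite -mulr_sumr; under eq_bigr do rewrite -wE.
by rewrite sw le_eqVlt; apply/orP; left; apply/eqP; ring.
Qed.

End LargePrimes.

(** * Small primes *)

Lemma exprn_le (F : realFieldType) n (a b : F) : 0 <= a -> a <= b -> a ^+ n <= b ^+ n.
Proof. by move=> a0 ab; rewrite lerXn2r ?nnegrE // (le_trans a0). Qed.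

(** At p the factor is 1 + 2 / p to first order, so 6 x + 1 and 6 x + 5 together give about 1 + 2 /
    (3 x), below 1 + 3 / (4 x + 1). *)
Lemma growth_step (F : realFieldType) (x : F) : 3 <= x ->
  ((6 * x + 1) ^+ 2 + 1) / (6 * x + 1 - 1) ^+ 2 *
  (((6 * x + 5) ^+ 2 + 1) / (6 * x + 5 - 1) ^+ 2) <= (4 * x + 4) / (4 * x + 1).
Proof.
move=> x3; rewrite mulf_div.
have p1 : 0 < 6 * x + 1 - 1 by lra.
have p5 : 0 < 6 * x + 5 - 1 by lra.
have p4 : 0 < 4 * x + 1 by lra.
rewrite ler_pdivrMr; last by rewrite mulr_gt0 ?exprn_gt0.
rewrite mulrAC ler_pdivlMr // -subr_ge0.
have -> : (4 * x + 4) * ((6 * x + 1 - 1) ^+ 2 * (6 * x + 5 - 1) ^+ 2)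
    - ((6 * x + 1) ^+ 2 + 1) * ((6 * x + 5) ^+ 2 + 1) * (4 * x + 1) =
    (x - 3) * (432 * x ^+ 3 + 1008 * x ^+ 2 + 1872 * x + 4976) + 14876 by ring.
have x0 : 0 <= x by lra.
have x2 := exprn_ge0 2 x0; have x4 := exprn_ge0 3 x0.
apply: addr_ge0; last exact: ler0n.
by apply: mulr_ge0; lra.
Qed.

(** One step grows by at most (1 + 1 / x)^(3/4), which telescopes to x^(3/4); fourth powers avoid
    the root. *)
Lemma growth_power (F : realFieldType) (x : F) : 3 <= x ->
  ((4 * x + 4) / (4 * x + 1)) ^+ 4 <= (x + 1) ^+ 3 / x ^+ 3.
Proof.
move=> x3; have x0 : 0 < x by lra.
have p4 : 0 < 4 * x + 1 by lra.
have p1 : 0 <= x + 1 by lra.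
rewrite expr_div_n ler_pdivrMr ?exprn_gt0 // mulrAC ler_pdivlMr ?exprn_gt0 //.
have -> : (4 * x + 4) ^+ 4 * x ^+ 3 = (x + 1) ^+ 3 * (256 * (x + 1) * x ^+ 3) by ring.
rewrite ler_wpM2l ?exprn_ge0 // -subr_ge0.
have -> : (4 * x + 1) ^+ 4 - 256 * (x + 1) * x ^+ 3 = 96 * x ^+ 2 + 16 * x + 1 by ring.
by have := sqr_ge0 x; lra.
Qed.

(** With y at most c^(1/4) x^(3/4), the condition c k^4 < x gives k y < x. *)
Lemma root4_lt (F : realFieldType) (y c x k : F) :
  0 <= y -> 0 <= k -> 0 < x -> y ^+ 4 <= c * x ^+ 3 -> c * k ^+ 4 < x ->
  y * (4 * k) < 6 * x.
Proof.
move=> y0 k0 x0 yc ck.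
rewrite ltNge; apply/negP => le_xy.
have x60 : 0 <= 6 * x by rewrite mulr_ge0 ?ltW.
have := exprn_le 4 x60 le_xy; apply/negP; rewrite -ltNge.
have -> : (y * (4 * k)) ^+ 4 = 256 * k ^+ 4 * y ^+ 4 by ring.
have k4 : 0 <= 256 * k ^+ 4 by apply: mulr_ge0; [exact: ler0n|exact: exprn_ge0].
apply: le_lt_trans (ler_wpM2l k4 yc) _.
have -> : 256 * k ^+ 4 * (c * x ^+ 3) = 256 * (c * k ^+ 4) * x ^+ 3 by ring.
have -> : (6 * x) ^+ 4 = 1296 * x * x ^+ 3 by ring.
rewrite ltr_pM2r; last exact: exprn_gt0.
lra.
Qed.

Section SmallPrimes.

Let dg p : rat := diag_growth (ratio rat p).
Let g p : rat := if prime p then dg p else 1.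
Let f n : rat := \prod_(0 <= p < n) g p.

Lemma diag_growth_ratio_ge1 p : 1 <= diag_growth (ratio rat p).
Proof. by apply: diag_growth_ge1; [exact: ratio_gt0|exact: ratio_le_half]. Qed.

Lemma diag_growth_nat (p : nat) : (2 <= p)%N ->
  diag_growth (ratio rat p) = (p%:R ^+ 2 + 1) / (p%:R - 1) ^+ 2.
Proof.
move=> p2; rewrite /ratio (maxn_idPl p2).
have : 2 <= p%:R :> rat by rewrite ler_nat.
move: (p%:R : rat) => x x2; rewrite /diag_growth; field; nonzero.
Qed.

Lemma not_prime_mul (a b : nat) : (1 < a)%N -> (1 < b)%N -> prime (a * b) = false.
Proof.
move=> a1 b1; apply/negP => /primeP[_ /(_ a)]; rewrite dvdn_mulr // => /(_ isT).
by case/orP => /eqP; nia.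
Qed.

Let f_step n : (0 < n)%N -> f (6 * n.+1)%N = f (6 * n)%N * (g (6 * n + 1)%N * g (6 * n + 5)%N).
Proof.
move=> n0; have -> : (6 * n.+1 = (6 * n).+1.+1.+1.+1.+1.+1)%N by lia.
rewrite /f !big_nat_recr //=.
have n1 a b c : (1 < a)%N -> (1 < b)%N -> c = (a * b)%N -> g c = 1.
  by move=> a1 b1 ->; rewrite /g not_prime_mul.
rewrite (n1 2%N (3 * n)%N (6 * n)%N); [|lia..].
rewrite (n1 2%N (3 * n + 1)%N (6 * n).+2); [|lia..].
rewrite (n1 3%N (2 * n + 1)%N (6 * n).+3); [|lia..].
rewrite (n1 2%N (3 * n + 2)%N (6 * n).+4); [|lia..].
by rewrite !mulr1 mulrA addn1 addnS addn4.
Qed.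

Let g_le p : (2 <= p)%N -> 0 <= g p <= (p%:R ^+ 2 + 1) / (p%:R - 1) ^+ 2.
Proof.
move=> p2; rewrite -diag_growth_nat // /g; have h := diag_growth_ratio_ge1 p.
by case: ifP => _; rewrite ?lexx ?h ?ler01 ?(le_trans ler01 h).
Qed.

Let f_ge0 n : 0 <= f n.
Proof.
apply: prodr_ge0 => p _; rewrite /g; case: ifP => // _.
exact: le_trans ler01 (diag_growth_ratio_ge1 p).
Qed.

Let g_step n : (3 <= n)%N ->
  (g (6 * n + 1)%N * g (6 * n + 5)%N) ^+ 4 <= n.+1%:R ^+ 3 / n%:R ^+ 3.
Proof.
move=> n3.
have /andP[g1 h1] : 0 <= g (6 * n + 1)%N <= _ := @g_le (6 * n + 1)%N ltac:(lia).
have /andP[g5 h5] : 0 <= g (6 * n + 5)%N <= _ := @g_le (6 * n + 5)%N ltac:(lia).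
have x3 : 3 <= n%:R :> rat by rewrite ler_nat.
have E c : (6 * n + c)%N%:R = 6 * n%:R + c%:R :> rat by rewrite natrD natrM.
rewrite -natr1; move: h1 h5; rewrite !E.
move: (n%:R : rat) x3 => x x3 h1 h5.
have lin : g (6 * n + 1)%N * g (6 * n + 5)%N <= (4 * x + 4) / (4 * x + 1).
  by apply: le_trans (ler_pM g1 g5 h1 h5) _; exact: growth_step.
have gg : 0 <= g (6 * n + 1)%N * g (6 * n + 5)%N by exact: mulr_ge0.
apply: le_trans (exprn_le 4 gg lin) _.
exact: growth_power.
Qed.

(* Primes above 3 are 1 or 5 mod 6, so the product of diag_growth over the
   primes below x is O(x^(3/4)). *)
Let f_growth n : (3 <= n)%N -> f (6 * n)%N ^+ 4 <= f 18 ^+ 4 * n%:R ^+ 3.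
Proof.
elim: n => [//|n IH]; rewrite leq_eqVlt => /predU1P[<-|n3].
  by rewrite ler_peMr ?exprn_ge0 // exprn_ege1 // ler1n.
have n0 : 0 < n%:R ^+ 3 :> rat by rewrite exprn_gt0 // ltr0n; lia.
rewrite f_step; last lia.
rewrite exprMn; apply: le_trans (ler_pM _ _ (IH n3) (g_step n3)) _; rewrite ?exprn_ge0 //.
  by rewrite mulr_ge0 //; have /andP[] := @g_le (6 * n + 1)%N ltac:(lia);
     have /andP[] := @g_le (6 * n + 5)%N ltac:(lia).
by rewrite -mulrA [n%:R ^+ 3 * _]mulrC divfK ?lt0r_neq0.
Qed.

Lemma prod_diag_growth_small (k n0 : nat) : exists P : nat, (n0 <= P)%N /\
  forall ps, uniq ps -> all prime ps -> all (ltn^~ P) ps ->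
    (\prod_(p <- ps) diag_growth (ratio rat p)) * (4 * k%:R) < P%:R.
Proof.
pose C := f 18 ^+ 4 * k%:R ^+ 4.
have C0 : 0 <= C by rewrite mulr_ge0 ?exprn_ge0.
(* The three summands provide the lower bound [n0], the range of [f_growth], and C < n as [root4_lt]
   requires. *)
pose n := (n0 + 3 + Num.bound C)%N.
have n3 : (3 <= n)%N by rewrite /n; lia.
exists (6 * n)%N; split; first by rewrite /n; lia.
move=> ps ups pps bps.
have le_f : \prod_(p <- ps) dg p <= f (6 * n)%N.
  have -> : \prod_(p <- ps) dg p = \prod_(p <- index_iota 0 (6 * n) | p \in ps) dg p.
    rewrite -[RHS]big_filter; apply: perm_big; apply: uniq_perm => //.
      by rewrite filter_uniq // iota_uniq.
    move=> p; rewrite mem_filter mem_index_iota; case: (boolP (p \in ps)) => //= pin.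
    by have := allP bps _ pin; rewrite /= => ->.
  (* Primes below 6 n that are missing from [ps] only contribute factors at least 1. *)
  rewrite big_mkcond /f; apply: ler_prod => p _; case: ifP => pin.
    by rewrite /g (allP pps) // lexx (le_trans ler01 (diag_growth_ratio_ge1 p)).
  by rewrite ler01 /g; case: ifP => // _; exact: diag_growth_ratio_ge1.
have nC : C < n%:R.
  apply: lt_le_trans (archi_boundP C0) _; rewrite ler_nat /n; lia.
have np : 0 < n%:R :> rat by rewrite ltr0n; lia.
apply: le_lt_trans (ler_wpM2r _ le_f) _; first by rewrite mulr_ge0.
by rewrite natrM; apply: (root4_lt (c := f 18 ^+ 4)); rewrite ?f_ge0 ?ler0n ?f_growth.
Qed.

(** Ratios at most 1/2 give factors at most 3^2, and there are at most P of them; this crude bound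
    depends on P alone. *)
Lemma prod_norm_growth_small (P : nat) ps : uniq ps -> all (ltn^~ P) ps ->
  \prod_(p <- ps) norm_growth (ratio rat p) <= (9 ^ P)%:R.
Proof.
move=> ups aps.
have size_ps : (size ps <= P)%N.
  rewrite -(size_iota 0 P) uniq_leq_size // => p /(allP aps).
  by rewrite mem_iota add0n.
apply: (@le_trans _ _ (\prod_(p <- ps) 9)).
  apply: ler_prod => p _; have r0 := ratio_gt0 rat p; have r1 := ratio_le_half rat p.
  rewrite (le_trans ler01 (norm_growth_ge1 r0 r1)) /norm_growth /=.
  have h : 0 <= (1 + ratio rat p) / (1 - ratio rat p) <= 3.
    by rewrite divr_ge0 ?ler_pdivrMr /=; lra.
  have /andP[h0 h3] := h; have := ler_pM h0 h0 h3 h3.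
  by rewrite -expr2; lra.
rewrite big_const_seq count_predT iter_mulr mulr1 natrX.
by rewrite ler_eXn2l.
Qed.

End SmallPrimes.

(** * From boxes to divisors *)

Definition delta (a b : nat) : nat := (lcmn a b %/ gcdn a b)%N.

Lemma gcdn_dvd_lcm a b : (gcdn a b %| lcmn a b)%N.
Proof. exact: dvdn_trans (dvdn_gcdl a b) (dvdn_lcml a b). Qed.

Lemma delta_gt0 a b : (0 < a)%N -> (0 < b)%N -> (0 < delta a b)%N.
Proof.
move=> a0 b0; rewrite divn_gt0 ?gcdn_gt0 ?a0 // dvdn_leq ?lcmn_gt0 ?a0 //.
exact: gcdn_dvd_lcm.
Qed.

Lemma deltaC a b : delta a b = delta b a.
Proof. by rewrite /delta gcdnC lcmnC. Qed.

Lemma logn_delta p a b : (0 < a)%N -> (0 < b)%N ->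
  logn p (delta a b) = (logn p a - logn p b + (logn p b - logn p a))%N.
Proof.
move=> a0 b0; rewrite logn_div ?gcdn_dvd_lcm // logn_lcm // logn_gcd //.
by rewrite /maxn /minn; case: ltnP; lia.
Qed.

Lemma logn_prod_expn (L : seq nat) (e : nat -> nat) q : uniq L -> all prime L ->
  logn q (\prod_(p <- L) p ^ e p)%N = if q \in L then e q else 0%N.
Proof.
elim: L => [|p L IH] /=; first by rewrite big_nil logn1.
move=> /andP[pL uL] /andP[pp aL]; rewrite big_cons lognM; first last.
- by rewrite big_seq prodn_cond_gt0 // => r /(allP aL) /prime_gt0; rewrite expn_gt0 => ->.
- by rewrite expn_gt0 prime_gt0.
rewrite IH // lognX logn_prime // inE; case: (eqVneq q p) => [->|_] /=.
  by rewrite (negPf pL) muln1 addn0.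
by rewrite muln0.
Qed.

Lemma prod_logn (L : seq nat) n : uniq L -> all prime L -> (0 < n)%N ->
  {subset primes n <= L} -> n = (\prod_(p <- L) p ^ logn p n)%N.
Proof.
move=> uL aL n0 sub; apply: eqn_from_log => // [|q].
  by rewrite big_seq prodn_cond_gt0 // => r /(allP aL) /prime_gt0; rewrite expn_gt0 => ->.
rewrite logn_prod_expn //; case: ifPn => // /negP qL; apply/eqP.
by rewrite eqn0Ngt logn_gt0; apply/negP => /sub.
Qed.

Section Encoding.
Variable m : nat.

(** [inord] sends exponents beyond m + 1 to a default value, so faithfulness requires all exponents
    below m + 2. *)
Fixpoint encode (ps : seq nat) (d : nat) : box m ps :=
  if ps is p :: ps' return box m ps then (inord (logn p d), encode ps' d) else tt.

Fixpoint decode (ps : seq nat) : box m ps -> nat :=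
  if ps is p :: ps' return box m ps -> nat
  then fun u => (p ^ (u.1 : 'I_m.+2) * decode u.2)%N else fun _ => 1%N.

Lemma decode_gt0 ps (u : box m ps) : all prime ps -> (0 < decode u)%N.
Proof.
elim: ps u => [//|p ps IH] [i u] /= /andP[/prime_gt0 p0 /IH h].
by rewrite muln_gt0 expn_gt0 p0 h.
Qed.

Lemma logn_decode ps (u : box m ps) q : all prime ps -> q \notin ps ->
  logn q (decode u) = 0%N.
Proof.
elim: ps u => [|p ps IH] /=; first by rewrite logn1.
move=> [i u] /andP[pp aps]; rewrite inE negb_or => /andP[qp qps] /=.
rewrite lognM ?expn_gt0 ?(prime_gt0 pp) ?decode_gt0 // IH // lognX logn_prime //.
by rewrite (negPf qp) muln0.
Qed.

Lemma primes_decode ps (u : box m ps) : all prime ps -> {subset primes (decode u) <= ps}.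
Proof.
move=> aps q; rewrite -logn_gt0; apply: contraLR => qps.
by rewrite logn_decode.
Qed.

(** The factor [r], prime to the list, absorbs the prime powers already split off in the induction
    and later the other half of the box. *)
Lemma ker_encode (F : realFieldType) ps (u : box m ps) (r d : nat) :
  uniq ps -> all prime ps -> (0 < r)%N -> all (fun p => logn p r == 0)%N ps ->
  all (fun p => logn p d < m.+2)%N ps ->
  ker (box_kernel F m ps) u (encode ps d) =
  \prod_(p <- ps) geom_kernel (ratio F p) (logn p (decode u * r)) (logn p d).
Proof.
elim: ps u r => [|p ps IH] /=; first by move=> *; rewrite big_nil.
move=> [i u] r /andP[pps ups] /andP[pp aps] r0 /andP[/eqP pr lr] /andP[pd ld].
rewrite big_cons /= inordK // -mulnA.
rewrite lognM ?muln_gt0 ?expn_gt0 ?(prime_gt0 pp) ?decode_gt0 //.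
rewrite pfactorK // lognM ?decode_gt0 // logn_decode // pr !addn0.
rewrite (IH u (p ^ i * r)%N) //; first by rewrite mulnCA.
- by rewrite muln_gt0 expn_gt0 (prime_gt0 pp).
- apply/allP => q qps; rewrite lognM ?expn_gt0 ?(prime_gt0 pp) // lognX logn_prime //.
  rewrite (eqP (allP lr q qps)) addn0; have [qp|_] := eqVneq q p; last by rewrite muln0.
  by rewrite -qp qps in pps.
Qed.

Lemma encode_inj ps d e : all (fun p => logn p d < m.+2)%N ps ->
  all (fun p => logn p e < m.+2)%N ps -> encode ps d = encode ps e ->
  {in ps, forall p, logn p d = logn p e}.
Proof.
elim: ps => [//|p ps IH] /= /andP[pd ld] /andP[pe le] [hp hps] q.
rewrite inE => /predU1P[->|]; last exact: IH.
by rewrite -(inordK pd) -(inordK pe) hp.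
Qed.

End Encoding.

Lemma prod_geom_kernel_delta (L : seq nat) t d : uniq L -> all prime L ->
  (0 < t)%N -> (0 < d)%N -> {subset primes t <= L} -> {subset primes d <= L} ->
  \prod_(p <- L) geom_kernel (ratio rat p) (logn p t) (logn p d) = (delta t d)%:R^-1.
Proof.
move=> uL aL t0 d0 tL dL.
have sub : {subset primes (delta t d) <= L}.
  move=> q; rewrite -logn_gt0 logn_delta // => h.
  have : (0 < logn q t)%N \/ (0 < logn q d)%N by lia.
  by rewrite !logn_gt0 => -[/tL|/dL].
rewrite [in RHS](prod_logn uL aL (delta_gt0 t0 d0) sub) natr_prod -prodfV.
rewrite big_seq [RHS]big_seq; apply: eq_bigr => p pL.
have p2 := prime_gt1 (allP aL p pL).
by rewrite logn_delta // natrX -exprVn /geom_kernel /ratio (maxn_idPl _).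
Qed.

Definition eta_potential (S : seq nat) (X : nat -> int) (t : nat) : rat :=
  \sum_(d <- S) (X d)%:~R / (delta t d)%:R.

Lemma sum_preimage (V : nmodType) (U : finType) (S : seq nat) (h : nat -> U)
    (G : nat -> V) :
  \sum_u \sum_(d <- S | h d == u) G d = \sum_(d <- S) G d.
Proof.
rewrite (exchange_big_dep predT) //=; apply: eq_bigr => d _.
by rewrite (big_pred1 (h d)) // => u; rewrite eq_sym.
Qed.

(** Transfers X to a box whose primes are split at P. Every point of the box is the exponent vector
    of some t > 0, so holomorphy gives a nonnegative potential there. *)
Lemma encode_exponents (P : nat) (S : seq nat) (X : nat -> int) :
  uniq S -> all (ltn 0%N) S ->
  exists m ps qs (X' : box m ps * box m qs -> int),
  [/\ [/\ uniq ps, all prime ps & all (ltn^~ P) ps],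
      sorted ltn qs /\ all (leq P) qs,
      forall u, exists2 t, (0 < t)%N &
        potential (tensor (box_kernel rat m ps) (box_kernel rat m qs))
          (fun d => (X' d)%:~R) u = eta_potential S X t,
      \sum_u X' u = \sum_(d <- S) X d &
      \sum_u `|X' u| = \sum_(d <- S) `|X d|].
Proof.
move=> uS S0.
(* N supplies the primes and, being at least every d in S, also bounds all exponents, so m = N
   works. *)
pose N := (\prod_(d <- S) d)%N.
have N0 : (0 < N)%N by rewrite /N big_seq prodn_cond_gt0 // => d /(allP S0).
have dN d : d \in S -> (d %| N)%N by move=> dS; rewrite /N (big_rem d) //= dvdn_mulr.
pose ps := [seq p <- primes N | (p < P)%N].
pose qs := [seq p <- primes N | (P <= p)%N].
have apr : all prime (primes N) by apply/allP => p; rewrite mem_primes => /and3P[].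
have aps : all prime ps by rewrite all_filter; apply/allP => p /(allP apr) /= ->; exact: implybT.
have aqs : all prime qs by rewrite all_filter; apply/allP => p /(allP apr) /= ->; exact: implybT.
have ups : uniq ps by rewrite filter_uniq // primes_uniq.
have uqs : uniq qs by rewrite filter_uniq // primes_uniq.
have sqs : sorted ltn qs by rewrite sorted_filter // ?sorted_primes //; exact: ltn_trans.
have dis p : p \in ps -> p \notin qs by rewrite !mem_filter ltnNge => /andP[/negPf ->].
have uL : uniq (ps ++ qs).
  rewrite cat_uniq ups uqs andbT /=; apply/hasPn => p /=; apply: contraL => /dis.
  by [].
have aL : all prime (ps ++ qs) by rewrite all_cat aps.
have inL p : p \in primes N -> p \in ps ++ qs.
  by rewrite mem_cat !mem_filter => ->; rewrite !andbT; case: ltnP.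
have Ssub d : d \in S -> {subset primes d <= ps ++ qs}.
  move=> dS p; rewrite mem_primes => /and3P[pp d0 pd]; apply: inL.
  by rewrite mem_primes pp N0 (dvdn_trans pd (dN _ dS)).
have logm d p : d \in S -> (logn p d < N.+2)%N.
  move=> dS; have d0 := allP S0 _ dS.
  apply: leq_trans (ltn_logl p d0) _.
  exact: leq_trans (dvdn_leq N0 (dN _ dS)) (leqW (leqnSn N)).
pose h d := (encode N ps d, encode N qs d).
pose X' u := \sum_(d <- S | h d == u) X d.
have pot u : potential (tensor (box_kernel rat N ps) (box_kernel rat N qs))
     (fun d => (X' d)%:~R) u = eta_potential S X (decode u.1 * decode u.2).
  rewrite /potential /eta_potential.
  transitivity (\sum_v \sum_(d <- S | h d == v)
     ker (tensor (box_kernel rat N ps) (box_kernel rat N qs)) u (h d) * (X d)%:~R).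
    apply: eq_bigr => v _; rewrite rmorph_sum mulr_sumr.
    by apply: eq_bigr => d /eqP ->.
  rewrite sum_preimage big_seq [RHS]big_seq; apply: eq_bigr => d dS.
  rewrite mulrC; congr (_ * _); rewrite /=.
  have d0 : (0 < d)%N := allP S0 _ dS.
  rewrite (@ker_encode N _ _ u.1 (decode u.2)) ?decode_gt0 //; first last.
  - by apply/allP => p _; exact: logm.
  - by apply/allP => p pps; rewrite logn_decode // dis.
  rewrite (@ker_encode N _ _ u.2 (decode u.1)) ?decode_gt0 //; first last.
  - by apply/allP => p _; exact: logm.
  - by apply/allP => p pqs; rewrite logn_decode //; apply: contraL pqs => /dis.
  rewrite [(decode u.2 * _)%N]mulnC -big_cat.
  apply: prod_geom_kernel_delta => //; rewrite ?muln_gt0 ?decode_gt0 //; last exact: Ssub.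
  move=> p; rewrite primesM ?decode_gt0 // mem_cat => /orP[/primes_decode->|/primes_decode->] //.
  by rewrite orbT.
(* Absolute values pass through the fibre sums because [h] is injective on S: every fibre has at
   most one element. *)
have norms : \sum_u `|X' u| = \sum_(d <- S) `|X d|.
  symmetry.
  rewrite -(sum_preimage S h); apply: eq_bigr => u _; rewrite /X'.
  have [/hasP[d dS /eqP hd]|/hasPn no] := boolP (has (fun d => h d == u) S); last first.
    have no1 d : (h d == u) && (d \in S) -> X d = 0 by case/andP=> hd /no; rewrite /= hd.
    by rewrite !big1_seq ?normr0 // => d /no1 ->; rewrite ?normr0.
  have only e : e \in S -> (h e == u) = (e == d).
    move=> eS; apply/eqP/eqP => [he|-> //]; apply: eqn_from_log.
    + exact: (allP S0).
    + exact: (allP S0).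
    move=> p; have [pL|pL] := boolP (p \in ps ++ qs); last first.
      have log0 a : a \in S -> logn p a = 0%N.
        move=> aS; apply/eqP; rewrite eqn0Ngt logn_gt0; apply: contra pL.
        exact: Ssub.
      by rewrite !log0.
    have [h1 h2] : encode N ps e = encode N ps d /\ encode N qs e = encode N qs d.
      by move: he; rewrite -hd /h => -[].
    move: pL; rewrite mem_cat => /orP[] pin.
      by apply: (encode_inj _ _ h1) pin; apply/allP => q _; exact: logm.
    by apply: (encode_inj _ _ h2) pin; apply/allP => q _; exact: logm.
  have single (G : nat -> int) : \sum_(e <- S | h e == u) G e = G d.
    rewrite big_mkcond (bigD1_seq d) //= hd eqxx big1_seq ?addr0 // => e /andP[ed eS].
    by rewrite only // (negPf ed).
  by rewrite !single.
exists N, ps, qs, X'; split => //.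
- by split => //; rewrite all_filter; apply/allP => p _; exact: implybb.
- by split => //; rewrite all_filter; apply/allP => p _; exact: implybb.
- by move=> u; exists (decode u.1 * decode u.2)%N; rewrite ?muln_gt0 ?decode_gt0 ?pot.
- by rewrite sum_preimage.
Qed.

Theorem exponent_norm_bound (k : int) : exists R : nat, forall S X,
  uniq S -> all (ltn 0%N) S ->
  (forall t, (0 < t)%N -> 0 <= eta_potential S X t) ->
  \sum_(d <- S) X d = k -> \sum_(d <- S) `|X d| <= R%:Z.
Proof.
case: k => k; last first.
  (* A negative total contradicts the nonnegative potential, the weights being positive. *)
  exists 0%N => S X uS S0 Y0 Sk.
  have [m [ps [qs [X' [_ _ pot sumX _]]]]] := encode_exponents 0 X uS S0.
  have : 0 <= (\sum_u X' u)%:~R :> rat.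
    rewrite rmorph_sum -(sum_weight_potential (tensor (box_kernel rat m ps) (box_kernel rat m qs))).
    apply: sumr_ge0 => u _; have [t t0 ->] := pot u.
    by rewrite mulr_ge0 ?Y0 // ltW // ker_weight_gt0.
  by rewrite ler0z sumX Sk.
have [P [kP smallP]] := prod_diag_growth_small k (25 * k.+1)%N.
exists (9 ^ P * (2 * k ^ 2))%N => S X uS S0 Y0 Sk.
have [m [ps [qs [X' [[ups aps psP] [sqs qsP] pot sumX normX]]]]] := encode_exponents P X uS S0.
have Y0' u : 0 <= potential (tensor (box_kernel rat m ps) (box_kernel rat m qs))
     (fun d => (X' d)%:~R) u.
  by have [t t0 ->] := pot u; exact: Y0.
have Sk' : \sum_u X' u = k%:Z by rewrite sumX.
have bound := holomorphic_box_norm kP sqs qsP (smallP ps ups aps psP) Y0' Sk'.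
rewrite -normX -(ler_int rat); apply: le_trans bound _.
rewrite -pmulrn natrM [(2 * k ^ 2)%:R]natrM [(k ^ 2)%:R]natrX.
apply: ler_wpM2r; first by rewrite mulr_ge0 ?exprn_ge0 ?ler0n.
exact: prod_norm_growth_small.
Qed.

(** * Clusters *)

Lemma dvdn_from_log a b : (0 < a)%N -> (0 < b)%N ->
  (forall p, logn p a <= logn p b)%N -> (a %| b)%N.
Proof.
move=> a0 b0 h; apply/(dvdn_partP _ a0) => p; rewrite mem_primes => /andP[pp _].
by rewrite p_part pfactor_dvdn.
Qed.

Lemma delta_triangle a b c : (0 < a)%N -> (0 < b)%N -> (0 < c)%N ->
  (delta a c <= delta a b * delta b c)%N.
Proof.
move=> a0 b0 c0; apply: dvdn_leq; first by rewrite muln_gt0 !delta_gt0.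
apply: dvdn_from_log; rewrite ?muln_gt0 ?delta_gt0 // => p.
by rewrite lognM ?delta_gt0 // !logn_delta //; lia.
Qed.

(** The point nearest to t in the box of multiples of g that divide l: each exponent of t is clamped
    to an interval. *)
Definition clamp (g l t : nat) : nat := lcmn g (gcdn t l).

Section Clamp.
Variables (g l t : nat).
Hypotheses (g0 : (0 < g)%N) (gl : (g %| l)%N) (l0 : (0 < l)%N) (t0 : (0 < t)%N).

Lemma clamp_gt0 : (0 < clamp g l t)%N.
Proof. by rewrite lcmn_gt0 g0 gcdn_gt0 t0. Qed.

Lemma clamp_ge : (g %| clamp g l t)%N. Proof. exact: dvdn_lcml. Qed.

Lemma clamp_le : (clamp g l t %| l)%N.
Proof. by rewrite dvdn_lcm gl dvdn_gcdr. Qed.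

(** In each coordinate the clamped exponent lies between those of t and d, so the l^1 distances add
    up. *)
Lemma delta_clamp d : (0 < d)%N -> (g %| d)%N -> (d %| l)%N ->
  delta t d = (delta t (clamp g l t) * delta (clamp g l t) d)%N.
Proof.
move=> d0 gd dl; have c0 := clamp_gt0.
apply: eqn_from_log; rewrite ?muln_gt0 ?delta_gt0 // => p.
rewrite lognM ?delta_gt0 // !logn_delta //.
have h1 := dvdn_leq_log p d0 gd; have h2 := dvdn_leq_log p l0 dl.
have -> : logn p (clamp g l t) = maxn (logn p g) (minn (logn p t) (logn p l)).
  by rewrite logn_lcm ?gcdn_gt0 ?t0 // logn_gcd.
move: (logn p g) (logn p t) (logn p l) (logn p d) h1 h2 => x y z w.
by clear; lia.
Qed.

End Clamp.

(** Divisibility, rather than mere size, gives the potential of a block inside its box the common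
    denominator l / g. *)
Lemma delta_dvd_box g l a b : (0 < g)%N -> (0 < l)%N ->
  (g %| a)%N -> (a %| l)%N -> (g %| b)%N -> (b %| l)%N -> (delta a b %| l %/ g)%N.
Proof.
move=> g0 l0 ga al gb bl.
have gl := dvdn_trans ga al.
have a0 := dvdn_gt0 l0 al; have b0 := dvdn_gt0 l0 bl.
apply: dvdn_from_log; rewrite ?delta_gt0 ?divn_gt0 // ?(dvdn_leq l0 gl) // => p.
rewrite logn_delta // logn_div //.
have := dvdn_leq_log p a0 ga; have := dvdn_leq_log p b0 gb.
have := dvdn_leq_log p l0 al; have := dvdn_leq_log p l0 bl.
by move: (logn p g) (logn p a) (logn p l) (logn p b) => x y z w; clear; lia.
Qed.

(** In exponents, the width of the joint box is at most the two widths plus the distance between a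
    point of each. *)
Lemma box_merge g1 l1 g2 l2 a b : (0 < g1)%N -> (0 < l1)%N -> (0 < g2)%N -> (0 < l2)%N ->
  (g1 %| a)%N -> (a %| l1)%N -> (g2 %| b)%N -> (b %| l2)%N ->
  (lcmn l1 l2 %/ gcdn g1 g2 <= (l1 %/ g1) * (l2 %/ g2) * delta a b)%N.
Proof.
move=> g10 l10 g20 l20 ga al gb bl.
have gl1 := dvdn_trans ga al; have gl2 := dvdn_trans gb bl.
have a0 := dvdn_gt0 l10 al; have b0 := dvdn_gt0 l20 bl.
have q1 : (0 < l1 %/ g1)%N by rewrite divn_gt0 // dvdn_leq.
have q2 : (0 < l2 %/ g2)%N by rewrite divn_gt0 // dvdn_leq.
have gl : (gcdn g1 g2 %| lcmn l1 l2)%N.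
  exact: dvdn_trans (dvdn_gcdl _ _) (dvdn_trans gl1 (dvdn_lcml _ _)).
have l0 : (0 < lcmn l1 l2)%N by rewrite lcmn_gt0 l10.
apply: dvdn_leq; first by rewrite !muln_gt0 q1 q2 delta_gt0.
apply: dvdn_from_log; rewrite ?muln_gt0 ?q1 ?q2 ?delta_gt0 //.
  by rewrite divn_gt0 ?gcdn_gt0 ?g10 // dvdn_leq.
move=> p; rewrite !lognM ?muln_gt0 ?q1 ?q2 ?delta_gt0 // logn_delta // logn_div //.
rewrite logn_lcm // logn_gcd // !logn_div //.
have := dvdn_leq_log p a0 ga; have := dvdn_leq_log p b0 gb.
have := dvdn_leq_log p l10 al; have := dvdn_leq_log p l20 bl.
move: (logn p g1) (logn p a) (logn p l1) (logn p b) (logn p g2) (logn p l2) => x y z w u v.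
by clear; lia.
Qed.

Section Clusters.
Variables (S : seq nat) (X : nat -> int) (R : nat).
Hypotheses (S0 : all (ltn 0%N) S) (XR : \sum_(d <- S) `|X d| <= R%:Z)
  (hol : forall t, (0 < t)%N -> 0 <= eta_potential S X t).

Let Spos d : d \in S -> (0 < d)%N. Proof. exact: (allP S0). Qed.

(* A far away remainder of the support contributes less than 1/b to the
   potential inside the box, where the potential of the block lies in (1/b)Z. *)
Lemma block_potential_ge0 (c : pred nat) (g l b : nat) :
  (0 < g)%N -> (g %| l)%N -> (0 < l)%N -> (l <= b * g)%N -> has c S ->
  (forall d, d \in S -> c d -> (g %| d)%N && (d %| l)%N) ->
  (forall d e, d \in S -> e \in S -> c d -> ~~ c e -> b ^ 2 * R.+1 <= delta d e)%N ->
  forall t, (0 < t)%N -> 0 <= eta_potential [seq d <- S | c d] X t.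
Proof.
move=> g0 gl l0 lb /hasP[d0 d0S cd0] inbox far t t0.
(* By [delta_clamp] the potentials of the block at t and t' have the same sign, so a point inside
   the box is enough. *)
pose t' := clamp g l t; have t'0 : (0 < t')%N by exact: clamp_gt0.
pose beta := (l %/ g)%N.
have beta0 : (0 < beta)%N by rewrite divn_gt0 // dvdn_leq.
have betab : (beta <= b)%N by rewrite leq_divLR // mulnC mulnC.
have b0 : (0 < b)%N by exact: leq_trans betab.
have dvd d : d \in S -> c d -> (delta t' d %| beta)%N.
  move=> dS /(inbox _ dS)/andP[gd dl]; apply: delta_dvd_box => //.
    exact: clamp_ge.
  exact: clamp_le.
pose z := \sum_(d <- S | c d) X d * (beta %/ delta t' d)%N%:Z.
have zE : \sum_(d <- S | c d) (X d)%:~R / (delta t' d)%:R = z%:~R / beta%:R :> rat.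
  rewrite /z rmorph_sum mulr_suml big_seq_cond [RHS]big_seq_cond.
  apply: eq_bigr => d /andP[dS cd]; rewrite rmorphM /= -mulrA; congr (_ * _).
  have dd0 : (0 < delta t' d)%N by rewrite delta_gt0 // Spos.
  rewrite -pmulrn -[X in _ / X%:R](divnK (dvd d dS cd)) natrM invfM mulrA mulfV ?mul1r //.
  by rewrite pnatr_eq0 -lt0n divn_gt0 // dvdn_leq // dvd.
have z0 : 0 <= z.
  rewrite leNgt; apply/negP => zneg.
  have z1 : z%:~R / beta%:R <= - b%:R^-1 :> rat.
    have zm1 : z%:~R <= -1 :> rat.
      by rewrite (_ : -1 = (-1)%:~R) // ler_int; lia.
    apply: le_trans (_ : - beta%:R^-1 <= _).
      by rewrite -mulN1r ler_wpM2r ?invr_ge0 ?ler0n.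
    by rewrite lerN2 lef_pV2 ?posrE ?ltr0n // ler_nat.
  have rest : \sum_(e <- S | ~~ c e) (X e)%:~R / (delta t' e)%:R < b%:R^-1 :> rat.
    have step : \sum_(e <- S | ~~ c e) (X e)%:~R / (delta t' e)%:R <=
        (\sum_(e <- S) `|X e|)%:~R / (b * R.+1)%:R :> rat.
      rewrite rmorph_sum mulr_suml [leRHS](bigID c) /= -[leLHS]add0r; apply: lerD.
        by apply: sumr_ge0 => d _; rewrite divr_ge0 ?ler0z ?ler0n.
      rewrite big_seq_cond [leRHS]big_seq_cond; apply: ler_sum => e /andP[eS ce].
      have e0 := Spos eS; have dd0 := delta_gt0 t'0 e0.
      (* The separation at [d0] is carried over by the triangle inequality through t', as
         [delta d0 t'] is at most b. *)
      have big_delta : (b * R.+1 <= delta t' e)%N.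
        rewrite -(leq_pmul2l b0) mulnA mulnn.
        apply: leq_trans (far d0 e d0S eS cd0 ce) _.
        apply: leq_trans (delta_triangle (Spos d0S) t'0 e0) _.
        rewrite leq_mul2r; apply/orP; right; apply: leq_trans betab.
        by rewrite deltaC dvdn_leq // dvd.
      apply: (@le_trans _ _ (`|X e|%:~R / (delta t' e)%:R)).
        by rewrite ler_wpM2r ?invr_ge0 ?ler0n // ler_int ler_norm.
      rewrite ler_wpM2l ?ler0z // lef_pV2 ?posrE ?ltr0n ?muln_gt0 ?b0 //.
      by rewrite ler_nat.
    apply: le_lt_trans step _; rewrite natrM invfM mulrCA -[ltRHS]mulr1.
    rewrite ltr_pM2l ?invr_gt0 ?ltr0n // ltr_pdivrMr ?ltr0n // mul1r.
    apply: (@le_lt_trans _ _ R%:R); last by rewrite ltr_nat.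
    by rewrite pmulrn ler_int.
  (* A negative z would make the potential at t' at most -1 / b plus something less than 1 / b,
     against [hol]. *)
  have := hol t'0; rewrite /eta_potential (bigID c) /= zE.
  by move: z1 rest; set u := z%:~R / _; set v := \sum_(e <- S | _) _; lra.
rewrite /eta_potential big_filter.
have -> : \sum_(d <- S | c d) (X d)%:~R / (delta t d)%:R =
   (delta t t')%:R^-1 * (z%:~R / beta%:R) :> rat.
  rewrite -zE mulr_sumr big_seq_cond [RHS]big_seq_cond.
  apply: eq_bigr => d /andP[dS cd]; have /andP[gd dl] := inbox d dS cd.
  by rewrite (delta_clamp g0 l0 t0 (Spos dS) gd dl) natrM invfM mulrCA mulrA.
by rewrite mulr_ge0 ?invr_ge0 ?ler0n // divr_ge0 ?ler0n // ler0z.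
Qed.

(** Each step gives the size of a box holding two boxes of size b with points at [delta] below b^2
    (R + 1), the threshold for merging; n counts the merges. *)
Fixpoint merge_bound (n b : nat) : nat :=
  if n is n'.+1 then merge_bound n' (b * b * (b ^ 2 * R.+1)) else b.

Lemma merge_bound_ge n b : (0 < b)%N -> (b <= merge_bound n b)%N.
Proof.
elim: n b => [//|n IH] b b0 /=.
have h : (b <= b * b * (b ^ 2 * R.+1))%N.
  by rewrite -mulnA leq_pmulr // !muln_gt0 b0.
by apply: leq_trans h _; apply: IH; rewrite !muln_gt0 b0.
Qed.

Definition boxed (c : pred nat) (b : nat) : Prop := exists g l,
  [/\ (0 < g)%N, (g %| l)%N, (0 < l)%N, (l <= b * g)%N &
      forall d, d \in S -> c d -> (g %| d)%N && (d %| l)%N].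

Definition splits : Prop := exists c : pred nat,
  [/\ has c S, has (predC c) S,
      forall t, (0 < t)%N -> 0 <= eta_potential [seq d <- S | c d] X t &
      forall t, (0 < t)%N -> 0 <= eta_potential [seq d <- S | ~~ c d] X t].

Lemma boxed_le c b b' : (b <= b')%N -> boxed c b -> boxed c b'.
Proof.
move=> bb' [g [l [g0 gl l0 lb h]]]; exists g, l; split => //.
by apply: leq_trans lb _; rewrite leq_mul2r bb' orbT.
Qed.

Lemma boxed_single b (lab : nat -> nat) : (0 < b)%N ->
  (forall x, x \in map lab S -> boxed (fun d => lab d == x) b) ->
  (forall d e, d \in S -> e \in S -> lab d = lab e) -> boxed predT b.
Proof.
move=> b0 box same; have [/hasP[d dS _]|/hasPn none] := boolP (has predT S).
  have [g [l [g0 gl l0 lb h]]] := box _ (map_f lab dS).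
  by exists g, l; split => // e eS _; apply: h => //; rewrite (same e d).
by exists 1%N, 1%N; split; rewrite ?muln1 // => d /none.
Qed.

(** Induction on the number of labels, which name the clusters. Two close clusters are merged, at
    the cost of a larger b; if none are close, every cluster is holomorphic by itself, and two
    clusters already give a splitting. *)
Lemma splits_or_boxed n b (lab : nat -> nat) : (0 < b)%N ->
  (size (undup (map lab S)) <= n.+1)%N ->
  (forall x, x \in map lab S -> boxed (fun d => lab d == x) b) ->
  splits \/ boxed predT (merge_bound n b).
Proof.
elim: n b lab => [|n IH] b lab b0 sz box.
  right; apply: (boxed_single b0 box) => d e dS eS; apply/eqP/negPn/negP => ne.
  have : uniq [:: lab d; lab e] by rewrite /= inE ne.
  move=> /(@uniq_leq_size _ _ (undup (map lab S))) h; move: sz; rewrite leqNgt h // => x.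
  by rewrite !inE mem_undup => /orP[] /eqP ->; rewrite map_f.
pose near d e := [&& d \in S, e \in S, lab d != lab e & (delta d e < b ^ 2 * R.+1)%N].
have [[d [e /and4P[dS eS labde de]]]|far] := pselect (exists d e, near d e).
  (* The cluster of e takes the label of that of d, so one label disappears. *)
  pose lab' x := if lab x == lab e then lab d else lab x.
  apply: (IH (b * b * (b ^ 2 * R.+1))%N lab').
  - by rewrite !muln_gt0 b0.
  - have sub : {subset undup (map lab' S) <= rem (lab e) (undup (map lab S))}.
      move=> x; rewrite mem_undup => /mapP[y yS ->]; rewrite mem_rem_uniq ?undup_uniq //.
      rewrite inE mem_undup /lab'; case: ifPn => h; first by rewrite labde map_f.
      by rewrite h map_f.
    apply: leq_trans (uniq_leq_size (undup_uniq _) sub) _.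
    by rewrite size_rem ?mem_undup ?map_f //; lia.
  move=> x /mapP[y yS ->]; have [h|h] := eqVneq (lab' y) (lab d); last first.
    have ye : lab y != lab e.
      by apply: contra h => /eqP ye; rewrite /lab' ye eqxx.
    have lab'y : lab' y = lab y by rewrite /lab' (negPf ye).
    rewrite lab'y in h *.
    have [g [l [g0 gl l0 lb hb]]] := boxed_le (merge_bound_ge 1 b0) (box _ (map_f lab yS)).
    exists g, l; split => // z zS; rewrite /lab'; case: ifP => _ /eqP hz.
      by rewrite hz eqxx in h.
    by apply: hb => //; rewrite hz.
  rewrite h.
  have [g1 [l1 [g10 gl1 l10 lb1 h1]]] := box _ (map_f lab dS).
  have [g2 [l2 [g20 gl2 l20 lb2 h2]]] := box _ (map_f lab eS).
  have /andP[gd dl] := h1 d dS (eqxx _); have /andP[ge el] := h2 e eS (eqxx _).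
  exists (gcdn g1 g2), (lcmn l1 l2).
  have gl : (gcdn g1 g2 %| lcmn l1 l2)%N.
    exact: dvdn_trans (dvdn_gcdl _ _) (dvdn_trans gl1 (dvdn_lcml _ _)).
  split => //; first by rewrite gcdn_gt0 g10.
  - by rewrite lcmn_gt0 l10.
  - rewrite -leq_divLR //; apply: leq_trans (box_merge g10 l10 g20 l20 gd dl ge el) _.
    apply: leq_mul; last exact: ltnW.
    by apply: leq_mul; rewrite leq_divLR.
  move=> z zS; rewrite /lab'; case: ifPn => hz hz2.
    have /andP[gz zl] := h2 z zS hz.
    by rewrite (dvdn_trans (dvdn_gcdr _ _) gz) (dvdn_trans zl (dvdn_lcmr _ _)).
  have /andP[gz zl] := h1 z zS hz2.
  by rewrite (dvdn_trans (dvdn_gcdl _ _) gz) (dvdn_trans zl (dvdn_lcml _ _)).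
have block x : x \in map lab S -> forall t, (0 < t)%N ->
    0 <= eta_potential [seq d <- S | lab d == x] X t.
  move=> xS; have [g [l [g0 gl l0 lb h]]] := box x xS.
  apply: (block_potential_ge0 g0 gl l0 lb) => //.
    by case/mapP: xS => y yS ->; apply/hasP; exists y.
  move=> d e dS eS /eqP dx ex; rewrite leqNgt; apply/negP => de; apply: far.
  by exists d, e; rewrite /near dS eS dx eq_sym ex.
have [[d [e /and3P[dS eS labde]]]|same] :=
  pselect (exists d e, [&& d \in S, e \in S & lab d != lab e]); last first.
  right; apply: boxed_le (merge_bound_ge n.+1 b0) _.
  apply: (boxed_single b0 box) => d e dS eS; apply/eqP/negPn/negP => ne.
  by apply: same; exists d, e; rewrite dS eS.
left; exists (fun x => lab x == lab d); split.
- by apply/hasP; exists d.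
- by apply/hasP; exists e => //=; rewrite eq_sym.
- exact/block/map_f.
(* The complement is the union of the other clusters, all of nonnegative potential. *)
move=> t t0; rewrite /eta_potential big_filter.
have -> : \sum_(i <- S | lab i != lab d) (X i)%:~R / (delta t i)%:R =
   \sum_(x <- undup (map lab S) | x != lab d) eta_potential [seq i <- S | lab i == x] X t.
  under [RHS]eq_bigr do rewrite /eta_potential big_filter.
  rewrite (exchange_big_dep (fun i => lab i != lab d)) /=; last first.
    by move=> x i xd /eqP ->.
  rewrite big_seq_cond [RHS]big_seq_cond; apply: eq_bigr => i /andP[iS id].
  rewrite (big_rem (lab i)) ?mem_undup ?map_f //= eqxx id /= big1_seq ?addr0 //.
  move=> x /andP[/andP[_ /eqP ix]]; rewrite mem_rem_uniq ?undup_uniq // inE ix eqxx.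
  by [].
rewrite big_seq_cond; apply: sumr_ge0 => x /andP[]; rewrite mem_undup => xS _.
exact: block.
Qed.

End Clusters.

(** * The eta function on the imaginary axis *)

Section ComplexProducts.
Variable R : realType.
Local Notation C := (R[i] : numFieldType).
Local Notation normc := (@Normc.normc R).

Lemma normc_le_ReIm (z : R[i]) : normc z <= `|complex.Re z| + `|complex.Im z|.
Proof.
case: z => a b /=; rewrite -[leRHS]ger0_norm ?addr_ge0 // -sqrtr_sqr ler_wsqrtr //.
rewrite sqrrD !real_normK ?num_real //.
by rewrite lerD2r lerDl mulrn_wge0 // mulr_ge0.
Qed.

Lemma cvg_complex (u : nat -> C) (x y : R) :
  (fun n => complex.Re (u n)) @ \oo --> x ->
  (fun n => complex.Im (u n)) @ \oo --> y ->
  u @ \oo --> (x +i* y : C).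
Proof.
move=> ux uy; apply/cvgrPdist_lt => e e0.
have [d d0 ed] : exists2 d : R, 0 < d & e = d%:C.
  move: e0; rewrite ltcE /= => /andP[/eqP Ie Re0]; exists (complex.Re e) => //.
  by case: e Ie {Re0} => a b /= ->.
have d2 : 0 < d / 2 by rewrite divr_gt0.
have /cvgrPdist_lt/(_ _ d2) hx := ux; have /cvgrPdist_lt/(_ _ d2) hy := uy.
near=> n; rewrite ed -[X in X < _]/((normc (x +i* y - u n))%:C) ltcR.
apply: le_lt_trans (normc_le_ReIm _) _.
rewrite [d]splitr; have -> : complex.Re (x +i* y - u n) = x - complex.Re (u n) by case: (u n).
have -> : complex.Im (x +i* y - u n) = y - complex.Im (u n) by case: (u n).
by apply: ltrD; near: n.
Unshelve. all: by end_near. Qed.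

Lemma geometric_sum_le (r : R) n : 0 < r -> r < 1 ->
  \sum_(1 <= m < n.+1) r ^+ m <= r / (1 - r).
Proof.
move=> r0 r1; have d0 : 0 < 1 - r by lra.
rewrite ler_pdivlMr //; suff -> : (\sum_(1 <= m < n.+1) r ^+ m) * (1 - r) = r - r ^+ n.+1.
  by rewrite gerBl exprn_ge0 // ltW.
elim: n => [|n IH]; first by rewrite big_geq // mul0r expr1 subrr.
by rewrite big_nat_recr //= mulrDl IH [r ^+ n.+2]exprS; ring.
Qed.

End ComplexProducts.

Section Eta.
Variable R : realType.
Local Notation C := (R[i] : numFieldType).

Lemma qpow_imaginary (s y : R) : qpow s (0 +i* y) = (expR (- (2 * pi * s * y)))%:C.
Proof.
rewrite /qpow /cexp /= !mul0r sub0r mulr0 addr0.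
by rewrite cos0 sin0 mulr1 mulr0.
Qed.

(** Weierstrass product inequality. *)
Lemma prod_1B_ge (x : nat -> R) n : (forall m, (0 < m)%N -> 0 <= x m <= 1) ->
  1 - \sum_(1 <= m < n.+1) x m <= \prod_(1 <= m < n.+1) (1 - x m).
Proof.
move=> x01; elim: n => [|n IH]; first by rewrite !big_geq // subr0.
rewrite !(@big_nat_recr _ _ _ n.+1) //=.
set s := \sum_(_ <= _ < _) _ in IH *; set p := \prod_(_ <= _ < _) _ in IH *.
have /andP[a0 a1] := x01 n.+1 isT.
have p1 : p <= 1.
  rewrite /p big_nat_cond; apply: prodr_ile1 => m; rewrite andbT => /andP[m0 _].
  by have /andP[] := x01 m m0; lra.
have : p * x n.+1 <= x n.+1 by rewrite ler_piMl.
by rewrite mulrBr mulr1; lra.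
Qed.

(** With q = e^(-2 pi y), the partial products decrease to a limit between 1 - 2 q and 1 - q, so
    [r], minus its logarithm, is comparable to q. *)
Lemma eta_imaginary (y : R) : 1 <= y -> exists2 r : R,
  expR (- (2 * pi * y)) <= r <= 4 * expR (- (2 * pi * y)) &
  eta (0 +i* y) = (expR (- (2 * pi * y / 24 + r)))%:C.
Proof.
move=> y1; set q := expR _.
have py : 4 <= 2 * pi * y :> R by have := pi_ge2 R; nra.
have q0 : 0 < q by exact: expR_gt0.
have q4 : 4 * q <= 1.
  rewrite /q expRN mulrC ler_pdivrMl ?expR_gt0 // mulr1.
  by apply: le_trans (expR_ge1Dx _); lra.
have q1 : q < 1 by lra.
pose w (n : nat) : R := \prod_(1 <= m < n.+1) (1 - q ^+ m).
have qm m : (0 < m)%N -> 0 <= q ^+ m <= 1.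
  by move=> _; rewrite exprn_ge0 ?exprn_ile1 ?ltW.
have w_ge n : 1 - 2 * q <= w n.
  apply: le_trans (prod_1B_ge n qm); rewrite lerB //.
  apply: le_trans (geometric_sum_le n q0 q1) _; rewrite ler_pdivrMr; nra.
have w_dec : nonincreasing_seq w.
  apply/nonincreasing_seqP => n; rewrite {1}/w big_nat_recr //= -/(w n).
  have := w_ge n; have := qm n.+1 isT.
  by move=> /andP[a0 a1] wn; rewrite ler_piMr; lra.
have cw : cvgn w.
  by apply: nonincreasing_is_cvgn => //; exists (1 - 2 * q) => _ [n _ <-]; exact: w_ge.
have L1 : limn w <= 1 - q.
  have := nonincreasing_cvgn_ge w_dec cw 1%N.
  by rewrite {2}/w big_nat1 expr1.
have L2 : 1 - 2 * q <= limn w.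
  by apply: limr_ge => //; apply: nearW => n; exact: w_ge.
have L0 : 0 < limn w by lra.
have prodE : (fun n => \prod_(1 <= m < n.+1) (1 - qpow m%:R (0 +i* y)) : C) = (fun n => (w n)%:C).
  apply/funext => n; rewrite /w rmorph_prod; apply: eq_bigr => m _.
  rewrite qpow_imaginary rmorphB rmorph1 /q -expRM_natl.
  by congr (1 - (expR _)%:C); ring.
have lim_prod : (fun n => (w n)%:C : C) @ \oo --> ((limn w) +i* 0 : C).
  by apply: cvg_complex => //=; exact: cvg_cst.
exists (- ln (limn w)).
  apply/andP; split.
    rewrite lerNr -[leRHS](expRK) ler_ln ?posrE ?expR_gt0 //.
    by apply: le_trans L1 _; have := expR_ge1Dx (- q); lra.
  rewrite lerNl -[leLHS](expRK) ler_ln ?posrE ?expR_gt0 //.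
  (* Here e^(-4 q) <= 1 / (1 + 4 q) <= 1 - 2 q, the last step by q <= 1/4. *)
  apply: le_trans L2; rewrite expRN invf_ple ?posrE ?expR_gt0 //; last lra.
  apply: le_trans (expR_ge1Dx (4 * q)); rewrite -div1r ler_pdivrMr; last lra.
  nra.
rewrite /eta prodE (cvg_lim _ lim_prod); last exact: norm_hausdorff.
rewrite qpow_imaginary complexr0 -rmorphM; congr (_%:C).
rewrite opprD opprK expRD lnK ?posrE //; congr (expR _ * _); ring.
Qed.

End Eta.

(** * Linear independence of the logarithms of eta(i d y) *)

Section Independence.
Variable R : realType.
Implicit Types (S : seq nat) (X : nat -> int).

Lemma expR_le_inv (y : R) : 1 <= y -> expR (- (2 * pi * y)) <= y^-1.
Proof.
move=> y1; rewrite expRN lef_pV2 ?posrE ?expR_gt0 //; last lra.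
by apply: le_trans (expR_ge1Dx _); have := pi_ge2 R; nra.
Qed.

(* The linear part of the exponents e(d y) dies by letting y grow, then the
   constant does, and then the smallest d dominates. *)
Lemma eta_exponents_independent (e : R -> R) S X (c : R) :
  (forall y, 1 <= y -> expR (- (2 * pi * y)) <= e y - 2 * pi * y / 24
                       <= 4 * expR (- (2 * pi * y))) ->
  uniq S -> all (ltn 0%N) S ->
  (forall d, d \in S -> X d != 0) ->
  (forall y, 1 <= y -> \sum_(d <- S) (X d)%:~R * e (d%:R * y) = c) ->
  S = [::].
Proof.
move=> eP uS S0 X0 sumc.
have Spos d : d \in S -> (0 < d)%N by exact: (allP S0).
pose q (y : R) := expR (- (2 * pi * y)); pose r y := e y - 2 * pi * y / 24.
pose M : R := \sum_(d <- S) `|(X d)%:~R|.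
(* The sum splits as s y + T y, a linear part and an exponentially small remainder [T]. *)
pose s : R := \sum_(d <- S) (X d)%:~R * (2 * pi * d%:R / 24).
pose T (y : R) := \sum_(d <- S) (X d)%:~R * r (d%:R * y).
have M0 : 0 <= M by exact: sumr_ge0.
have sT y : 1 <= y -> s * y + T y = c.
  move=> y1; rewrite -(sumc y y1) /s /T mulr_suml -big_split; apply: eq_bigr => d _ /=.
  by rewrite /r; ring.
have dy d (y : R) : d \in S -> 1 <= y -> 1 <= d%:R * y.
  move=> dS y1; have d1 : 1 <= d%:R :> R by rewrite ler1n Spos.
  by rewrite -[leLHS]mulr1 ler_pM.
have q_dec x y : x <= y -> q y <= q x.
  by move=> xy; rewrite /q ler_expR lerN2 ler_wpM2l // mulr_ge0 ?pi_ge0.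
have q0 y : 0 < q y by exact: expR_gt0.
have rq d (y : R) : d \in S -> 1 <= y -> q (d%:R * y) <= r (d%:R * y) <= 4 * q (d%:R * y).
  by move=> dS y1; apply: eP; exact: dy.
have TM y : 1 <= y -> `|T y| <= 4 * M * q y.
  move=> y1; apply: le_trans (ler_norm_sum _ _ _) _.
  rewrite mulrAC /M mulr_sumr big_seq [leRHS]big_seq; apply: ler_sum => d dS.
  rewrite normrM mulrC ler_wpM2r //; have /andP[r1 r2] := rq d y dS y1.
  rewrite ger0_norm; last exact: le_trans (ltW (q0 _)) r1.
  apply: le_trans r2 _; rewrite ler_wpM2l //; apply: q_dec.
  by rewrite ler_peMl ?ler1n ?Spos //; lra.
have qM y : 1 <= y -> 4 * M * q y <= 4 * M / y.
  by move=> y1; rewrite ler_wpM2l ?mulr_ge0 // expR_le_inv.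
have TM4 y : 1 <= y -> `|T y| <= 4 * M.
  move=> y1; apply: le_trans (TM y y1) (le_trans (qM y y1) _).
  by rewrite ler_pdivrMr ?ler_peMr ?mulr_ge0 //; lra.
have s0 : s = 0.
  apply/eqP; apply/negPn/negP => sn; have sp : 0 < `|s| by rewrite normr_gt0.
  (* Chosen so that |s| (y - 1) = 8 M + 1 exceeds |T 1| + |T y|. *)
  pose y := 1 + (8 * M + 1) / `|s|.
  have y1 : 1 <= y by rewrite lerDl divr_ge0 ?addr_ge0 ?mulr_ge0 // ltW.
  have : s * (y - 1) = T 1 - T y by have := sT y y1; have := sT 1 (lexx 1); lra.
  move/(congr1 Num.norm); rewrite normrM (ger0_norm (_ : 0 <= y - 1)); last by lra.
  have -> : `|s| * (y - 1) = 8 * M + 1.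
    by rewrite /y addrAC subrr add0r mulrC divfK ?lt0r_neq0.
  move=> h; have := ler_normB (T 1) (T y); rewrite -h.
  by have := TM4 1 (lexx 1); have := TM4 y y1; lra.
have c0 : c = 0.
  apply/eqP; apply/negPn/negP => cn; have cp : 0 < `|c| by rewrite normr_gt0.
  (* Chosen so that |c| y exceeds 4 M. *)
  pose y := 1 + 4 * M / `|c|.
  have y1 : 1 <= y by rewrite lerDl divr_ge0 ?mulr_ge0 // ltW.
  have cT : c = T y by rewrite -(sT y y1) s0 mul0r add0r.
  have := le_trans (TM y y1) (qM y y1); rewrite -cT; apply/negP; rewrite -ltNge.
  rewrite ltr_pdivrMr; last lra.
  have -> : `|c| * y = `|c| + 4 * M.
    by rewrite /y mulrDr mulr1 [_ * (_ / _)]mulrC divfK ?lt0r_neq0.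
  lra.
apply/eqP; rewrite -size_eq0 eqn0Ngt -has_predT; apply/negP => /hasP[d1 d1S _].
have ex : exists d, d \in S by exists d1.
case: (ex_minnP ex) => d0 d0S min0; have Xd0 := X0 d0 d0S.
(* This makes 4 M q(y) less than 1, so the other terms cannot cancel that of the smallest index
   [d0]. *)
pose y := 1 + 4 * M.
have y1 : 1 <= y by rewrite lerDl mulr_ge0.
have := sT y y1; rewrite s0 c0 mul0r add0r /T (bigD1_seq d0) //=.
move/eqP; rewrite addr_eq0 => /eqP /(congr1 Num.norm); rewrite normrN => h.
have /andP[r1 r2] := rq d0 y d0S y1.
have low : q (d0%:R * y) <= `|(X d0)%:~R * r (d0%:R * y)|.
  have r0 : 0 <= r (d0%:R * y) by exact: le_trans (ltW (q0 _)) r1.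
  rewrite normrM (ger0_norm r0); apply: le_trans r1 _; rewrite ler_peMl //.
  rewrite -intr_norm (_ : 1 = 1%:~R) // ler_int.
  by rewrite -gtz0_ge1 normr_gt0.
(* As d >= d0 + 1, q(d y) <= q(d0 y) q(y). *)
have up : `|\sum_(d <- S | d != d0) (X d)%:~R * r (d%:R * y)| <= 4 * M * (q (d0%:R * y) * q y).
  apply: le_trans (ler_norm_sum _ _ _) _.
  rewrite mulrAC /M mulr_sumr [leRHS](bigID (fun d => d != d0)) /= -[leLHS]addr0.
  apply: lerD; last by apply: sumr_ge0 => d _; rewrite mulr_ge0 // !mulr_ge0 // ltW.
  rewrite big_seq_cond [leRHS]big_seq_cond; apply: ler_sum => d /andP[dS dd0].
  rewrite normrM mulrC ler_wpM2r //; have /andP[r3 r4] := rq d y dS y1.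
  rewrite ger0_norm; last exact: le_trans (ltW (q0 _)) r3.
  apply: le_trans r4 _; rewrite ler_wpM2l // /q -expRD ler_expR -opprD lerN2.
  have d0d : (d0.+1)%:R <= d%:R :> R by rewrite ler_nat ltn_neqAle eq_sym dd0 min0.
  have -> : 2 * pi * (d0%:R * y) + 2 * pi * y = 2 * pi * (d0.+1%:R * y) :> R.
    by rewrite -natr1; ring.
  by rewrite ler_wpM2l ?mulr_ge0 ?pi_ge0 // ler_wpM2r //; lra.
have small : 4 * M * q y < 1.
  apply: le_lt_trans (qM y y1) _; rewrite ltr_pdivrMr; last lra.
  by rewrite mul1r /y ltrDr.
have := le_trans low (le_trans (_ : _ <= _) up); rewrite h lexx => /(_ isT).
apply/negP; rewrite -ltNge mulrCA gtr_pMr //.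
Qed.

End Independence.

(** * Exponents of eta quotients *)

Definition exponents_of (S : seq nat) (G : nat -> int) : exponents :=
  [fsfun d in [fset x in S]%fset => G d].

Lemma exponents_ofE S G d : exponents_of S G d = if d \in S then G d else 0.
Proof. by rewrite /exponents_of fsfunE !inE. Qed.

Lemma big_finsupp (V : Type) (idx : V) (op : Monoid.com_law idx) (X : exponents)
    (S : seq nat) (G : nat -> V) :
  uniq S -> {subset finsupp X <= S} -> (forall d, X d = 0 -> G d = idx) ->
  \big[op/idx]_(d <- S) G d = \big[op/idx]_(d <- finsupp X) G d.
Proof.
move=> uS sub G0; rewrite [LHS](bigID (fun d => d \in finsupp X)) /= [X in op _ X]big1 => [|d].
  rewrite Monoid.mulm1 -big_filter; apply: perm_big; apply: uniq_perm => //.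
  - by rewrite filter_uniq.
  - exact: fset_uniq.
  - by move=> d; rewrite mem_filter; case: (boolP (d \in finsupp X)) => //= /sub ->.
by rewrite memNfinsupp => /eqP /G0.
Qed.

Lemma dvdn_exp_level (X : exponents) d : d \in finsupp X -> (d %| exp_level X)%N.
Proof. by move=> dX; rewrite /exp_level (big_rem d) //= dvdn_lcml. Qed.

Lemma finsupp_gt0 (X : exponents) : X 0%N = 0 -> all (ltn 0%N) (finsupp X).
Proof.
move=> X0; apply/allP => -[|d] //=; by rewrite mem_finsupp X0 eqxx.
Qed.

Lemma exp_level_gt0 (X : exponents) : X 0%N = 0 -> (0 < exp_level X)%N.
Proof.
move=> /finsupp_gt0 X0; rewrite /exp_level big_seq; elim/big_ind: _ => //.
  by move=> a b a0 b0; rewrite lcmn_gt0 a0.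
by move=> d /(allP X0).
Qed.

Lemma exp_level_dvdn (X : exponents) N : {in finsupp X, forall d, (d %| N)%N} ->
  (exp_level X %| N)%N.
Proof.
move=> XN; rewrite /exp_level big_seq; elim/big_ind: _ => //.
by move=> a b aN bN; rewrite dvdn_lcm aN.
Qed.

Lemma delta_gcd a b : (0 < a)%N -> (0 < b)%N ->
  (delta a b)%:R^-1 = (gcdn b a ^ 2)%:R / (a%:R * b%:R) :> rat.
Proof.
move=> a0 b0; have g0 : (0 < gcdn b a)%N by rewrite gcdn_gt0 b0.
have e : (delta a b * gcdn b a ^ 2 = a * b)%N.
  by rewrite expnS expn1 mulnA [gcdn b a]gcdnC divnK ?gcdn_dvd_lcm // muln_lcm_gcd.
have gn : (gcdn b a ^ 2)%:R != 0 :> rat by rewrite pnatr_eq0 -lt0n expn_gt0 g0.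
by rewrite -natrM -e natrM invfM mulrCA mulfV // mulr1.
Qed.

(** Since gcd(d, t)^2 / d = t / [delta t d], the order is a positive multiple of the potential. *)
Lemma cusp_order_potential (X : exponents) t : X 0%N = 0 -> (0 < t)%N ->
  cusp_order (exp_level X) X t =
  24%:R^-1 * ((t * exp_level X)%:R / (gcdn (t ^ 2) (exp_level X))%:R) *
  eta_potential (finsupp X) X t.
Proof.
move=> X0 t0; have N0 := exp_level_gt0 X0; rewrite /cusp_order.
rewrite (@big_finsupp _ _ _ X (divisors (exp_level X))) ?divisors_uniq //; first last.
- by move=> d ->; rewrite mulr0.
- by move=> d dX; rewrite -dvdn_divisors // dvdn_exp_level.
rewrite -mulrA; congr (_ * _); rewrite /eta_potential mulr_sumr.
rewrite big_seq [RHS]big_seq; apply: eq_bigr => d dX.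
have d0 : (0 < d)%N := allP (finsupp_gt0 X0) d dX.
have t0' : t%:R != 0 :> rat by rewrite pnatr_eq0 -lt0n.
have d0' : d%:R != 0 :> rat by rewrite pnatr_eq0 -lt0n.
have g0' : (gcdn (t ^ 2) (exp_level X))%:R != 0 :> rat.
  by rewrite pnatr_eq0 -lt0n gcdn_gt0 N0 orbT.
by rewrite delta_gcd // !natrM; field; rewrite t0' d0' g0'.
Qed.

(** t times the potential has terms X_d gcd(d, t)^2 / d, which see t only through its gcd with the
    level. *)
Lemma eta_potential_gcd (X : exponents) t : X 0%N = 0 -> (0 < t)%N ->
  eta_potential (finsupp X) X t * t%:R =
  eta_potential (finsupp X) X (gcdn t (exp_level X)) * (gcdn t (exp_level X))%:R.
Proof.
move=> X0 t0; rewrite /eta_potential !mulr_suml big_seq [RHS]big_seq.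
apply: eq_bigr => d dX; have d0 : (0 < d)%N := allP (finsupp_gt0 X0) d dX.
have s0 : (0 < gcdn t (exp_level X))%N by rewrite gcdn_gt0 t0.
rewrite !delta_gcd // gcdnC [gcdn d (gcdn _ _)]gcdnCA (gcdn_idPl (dvdn_exp_level dX)) [gcdn t d]gcdnC.
have t0' : t%:R != 0 :> rat by rewrite pnatr_eq0 -lt0n.
have d0' : d%:R != 0 :> rat by rewrite pnatr_eq0 -lt0n.
have g0' : (gcdn t (exp_level X))%:R != 0 :> rat by rewrite pnatr_eq0 -lt0n.
by field; rewrite t0' d0' g0'.
Qed.

(** The divisors of the level control every t, by passing to the gcd of t with the level. *)
Lemma holomorphic_potentialP (X : exponents) : X 0%N = 0 ->
  (forall t, (t %| exp_level X)%N -> 0 <= cusp_order (exp_level X) X t) <->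
  (forall t, (0 < t)%N -> 0 <= eta_potential (finsupp X) X t).
Proof.
move=> X0; have N0 := exp_level_gt0 X0.
have pos t : (0 < t)%N ->
    0 < 24%:R^-1 * ((t * exp_level X)%:R / (gcdn (t ^ 2) (exp_level X))%:R) :> rat.
  move=> t0; rewrite mulr_gt0 ?invr_gt0 ?ltr0n //.
  by rewrite divr_gt0 ?ltr0n ?muln_gt0 ?t0 // gcdn_gt0 N0 orbT.
split=> h t.
  move=> t0; have s0 : (0 < gcdn t (exp_level X))%N by rewrite gcdn_gt0 t0.
  have := h _ (dvdn_gcdr t (exp_level X)).
  rewrite (cusp_order_potential X0 s0) (pmulr_rge0 _ (pos _ s0)) => h1.
  have tp : 0 < t%:R :> rat by rewrite ltr0n.
  by rewrite -(pmulr_lge0 _ tp) eta_potential_gcd // mulr_ge0.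
move=> tN; have t0 := dvdn_gt0 N0 tN.
rewrite (cusp_order_potential X0 t0); apply: mulr_ge0; [exact/ltW/pos|exact: h].
Qed.

(** * Uniqueness of the exponents of an eta quotient *)

Section EtaProducts.
Variable R : realType.
Implicit Types (X : exponents) (f : upper_half_plane R -> R[i]).

Let e (y : R) : R := - ln (complex.Re (eta (0 +i* y))).

Lemma eta_imaginary_ln (y : R) : 1 <= y -> eta (0 +i* y) = (expR (- e y))%:C.
Proof. by move=> y1; have [r _ h] := eta_imaginary y1; rewrite /e h /= opprK expRK. Qed.

Lemma eta_ln_bounds (y : R) : 1 <= y ->
  expR (- (2 * pi * y)) <= e y - 2 * pi * y / 24 <= 4 * expR (- (2 * pi * y)).
Proof.
move=> y1; have [r rb h] := eta_imaginary y1; rewrite /e h /= expRK opprK.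
by rewrite addrAC subrr add0r.
Qed.

Lemma expR_exprz (x : R) (n : int) : expR x ^ n = expR (n%:~R * x).
Proof.
case: n => n; first by rewrite -pmulrn expRM_natl.
by rewrite NegzE mulrNz mulNr expRN -pmulrn expRM_natl.
Qed.

Lemma imaginary_gt0 (y : R) : 1 <= y -> 0 < complex.Im (0 +i* y).
Proof. by move=> y1 /=; lra. Qed.

Definition imaginary_point (y : R) (y1 : 1 <= y) : upper_half_plane R :=
  exist _ (0 +i* y) (imaginary_gt0 y1).

Lemma eta_prod_imaginary X (y : R) (y1 : 1 <= y) : X 0%N = 0 ->
  eta_prod X (imaginary_point y1) =
  (expR (- \sum_(d <- finsupp X) (X d)%:~R * e (d%:R * y)))%:C.
Proof.
move=> X0; rewrite /eta_prod -sumrN expR_sum rmorph_prod /=.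
rewrite big_seq [RHS]big_seq; apply: eq_bigr => d dX.
have d1 : 1 <= d%:R :> R by rewrite ler1n; exact: (allP (finsupp_gt0 X0)).
have -> : d%:R * (0 +i* y) = 0 +i* (d%:R * y) :> R[i].
  have -> : d%:R = (d%:R)%:C :> R[i] by rewrite rmorph_nat.
  by rewrite /=; apply/eqP; rewrite eq_complex /= mulr0 !mul0r subrr addr0 !eqxx.
rewrite eta_imaginary_ln; last by rewrite -[leLHS]mulr1 ler_pM.
by rewrite -fmorphXz /= expR_exprz mulrN.
Qed.

Lemma eta_exponents_const (S : seq nat) (G : nat -> int) (c : R) :
  uniq S -> all (ltn 0%N) S ->
  (forall y, 1 <= y -> \sum_(d <- S) (G d)%:~R * e (d%:R * y) = c) ->
  forall d, d \in S -> G d = 0.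
Proof.
move=> uS S0 h d dS; apply/eqP/negPn/negP => Gd.
have : [seq d <- S | G d != 0] = [::].
  apply: (eta_exponents_independent eta_ln_bounds (X := G) (c := c)) => [|||y y1].
  - by rewrite filter_uniq.
  - by rewrite all_filter; apply/allP => x /(allP S0) /= ->; exact: implybT.
  - by move=> x; rewrite mem_filter => /andP[].
  rewrite -(h y y1) big_filter [RHS](bigID (fun d => G d != 0)) /= [X in _ + X]big1 ?addr0 //.
  by move=> x /negPn /eqP ->; rewrite mul0r.
by apply/eqP; rewrite -size_eq0 -lt0n size_filter -has_count; apply/hasP; exists d.
Qed.

(** Restricted to the imaginary axis and compared with y = 1, a constant product makes the
    combination of logarithms constant. *)
Lemma eta_prod_const X (c : R[i]) : X 0%N = 0 -> (forall z, eta_prod X z = c) ->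
  finsupp X = fset0.
Proof.
move=> X0 Xc; apply/eqP; apply/negPn/negP => /fset0Pn[d dX].
have := dX; rewrite mem_finsupp => /eqP; apply.
apply: (@eta_exponents_const (finsupp X) X
  (\sum_(d <- finsupp X) (X d)%:~R * e (d%:R * 1))) dX.
- exact: fset_uniq.
- exact: finsupp_gt0.
move=> y y1; apply: oppr_inj; apply: expR_inj; apply: complexI.
have h1 := eta_prod_imaginary y1 X0; have h2 := eta_prod_imaginary (lexx (1 : R)) X0.
exact: etrans (esym h1) (etrans (Xc _) (etrans (esym (Xc _)) h2)).
Qed.

(** The differences of the exponents give a vanishing combination of logarithms, trivial by
    independence. *)
Lemma expands_inj f X X' : expands f X -> expands f X' -> X = X'.
Proof.
move=> [X0 fX] [X0' fX'].
pose S := undup (finsupp X ++ finsupp X').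
have SX : {subset finsupp X <= S} by move=> d dX; rewrite mem_undup mem_cat dX.
have SX' : {subset finsupp X' <= S} by move=> d dX; rewrite mem_undup mem_cat dX orbT.
have zero : forall d, d \in S -> X d - X' d = 0.
  apply: (@eta_exponents_const S (fun d => X d - X' d) 0).
  - exact: undup_uniq.
  - apply/allP => d; rewrite mem_undup mem_cat => /orP[].
      exact: (allP (finsupp_gt0 X0)).
    exact: (allP (finsupp_gt0 X0')).
  have sumS (Y : exponents) (y : R) : {subset finsupp Y <= S} ->
      \sum_(d <- S) (Y d)%:~R * e (d%:R * y) =
      \sum_(d <- finsupp Y) (Y d)%:~R * e (d%:R * y).
    move=> SY; apply: big_finsupp => //; first exact: undup_uniq.
    by move=> d ->; rewrite mul0r.
  move=> y y1; under eq_bigr do rewrite rmorphB mulrBl.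
  rewrite sumrB (sumS X y SX) (sumS X' y SX').
  apply/eqP; rewrite subr_eq0; apply/eqP; apply: oppr_inj; apply: expR_inj; apply: complexI.
  by rewrite -(eta_prod_imaginary y1 X0) -(eta_prod_imaginary y1 X0') -fX fX'.
apply/fsfunP => d; have [dS|dS] := boolP (d \in S).
  by apply/eqP; rewrite -subr_eq0 zero.
have [dX dX'] : d \notin finsupp X /\ d \notin finsupp X'.
  by split; [apply: contra dS => /SX|apply: contra dS => /SX'].
by rewrite !fsfun_dflt.
Qed.

End EtaProducts.

(** * Factorization and finiteness *)

Lemma finsupp_exponents_of (S : seq nat) (G : nat -> int) d :
  (d \in finsupp (exponents_of S G)) = (d \in S) && (G d != 0).
Proof. by rewrite mem_finsupp exponents_ofE; case: ifP; rewrite ?eqxx. Qed.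

Lemma big_exponents_of (V : Type) (idx : V) (op : Monoid.com_law idx)
    (S : seq nat) (G : nat -> int) (K : nat -> int -> V) :
  uniq S -> (forall d, K d 0 = idx) ->
  \big[op/idx]_(d <- finsupp (exponents_of S G)) K d (exponents_of S G d) =
  \big[op/idx]_(d <- S) K d (G d).
Proof.
move=> uS K0; rewrite -(@big_finsupp _ _ _ _ S) //.
- by rewrite big_seq [RHS]big_seq; apply: eq_bigr => d dS; rewrite exponents_ofE dS.
- by move=> d; rewrite finsupp_exponents_of => /andP[].
- by move=> d ->.
Qed.

Section Main.
Variable R : realType.
Implicit Types (X : exponents) (f : upper_half_plane R -> R[i]).

Lemma expands_eta_prod X : X 0%N = 0 -> expands (eta_prod (R := R) X) X.
Proof. by []. Qed.

Section Block.
Variables (X : exponents) (c : pred nat).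
Hypotheses (X0 : X 0%N = 0) (cX : has c (finsupp X)).
Hypothesis potential_ge0 : forall t, (0 < t)%N ->
  0 <= eta_potential [seq d <- finsupp X | c d] X t.

Let Y := exponents_of [seq d <- finsupp X | c d] X.

Let Y0 : Y 0%N = 0.
Proof. by rewrite exponents_ofE X0 if_same. Qed.

Lemma block_holomorphic : holomorphic_eta_quotient (eta_prod (R := R) Y).
Proof.
exists Y; first exact: expands_eta_prod.
apply/(holomorphic_potentialP Y0) => t t0.
suff -> : eta_potential (finsupp Y) Y t = eta_potential [seq d <- finsupp X | c d] X t.
  exact: potential_ge0.
rewrite /eta_potential (@big_exponents_of _ _ _ _ _ (fun d (x : int) => x%:~R / (delta t d)%:R)) //.
  exact/filter_uniq/fset_uniq.
by move=> d; rewrite mul0r.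
Qed.

Lemma block_level : eta_quotient_on (exp_level X) (eta_prod (R := R) Y).
Proof.
exists (exp_level Y); first by exists Y.
apply: exp_level_dvdn => d; rewrite finsupp_exponents_of mem_filter => /andP[/andP[_ dX] _].
exact: dvdn_exp_level.
Qed.

Lemma block_nonconstant : nonconstant (eta_prod (R := R) Y).
Proof.
case=> a /(eta_prod_const Y0) Y1; have /hasP[d dX cd] := cX.
have : d \in finsupp Y by rewrite finsupp_exponents_of mem_filter cd dX -mem_finsupp.
by rewrite Y1 inE.
Qed.

End Block.

(** The factors are supported inside the support of X, so their levels divide that of X; they are
    nonconstant by independence. *)
Lemma splits_factorizable f X : expands f X -> splits (finsupp X) X ->
  factorizable_on (exp_level X) f.
Proof.
move=> [X0 fX] [c [h1 h2 p1 p2]].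
exists (eta_prod (exponents_of [seq d <- finsupp X | c d] X)),
       (eta_prod (exponents_of [seq d <- finsupp X | ~~ c d] X)); split.
- by split; [exact: block_holomorphic|exact: block_level].
- by split; [exact: block_holomorphic|exact: block_level].
- exact: block_nonconstant.
- exact: block_nonconstant.
move=> z; rewrite fX /eta_prod.
rewrite !(@big_exponents_of _ _ _ _ _ (fun d x => eta (d%:R * val z) ^ x)) ?filter_uniq ?fset_uniq //.
by rewrite !big_filter; exact: bigID.
Qed.

(** Dividing all indices by g gives h with f(z) = h(g z); primitivity forces h = f, which a finite
    nonempty support allows only for g = 1. *)
Lemma primitive_gcd f X g : primitive f -> expands f X -> finsupp X != fset0 ->
  (0 < g)%N -> {in finsupp X, forall d, g %| d}%N -> g = 1%N.
Proof.
move=> prim fX /fset0Pn[d dX] g0 gX; have [X0 fE] := fX.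
apply/eqP/negPn/negP => g1; apply: prim.
pose S := [seq (k %/ g)%N | k <- finsupp X].
pose X' := exponents_of S (fun k => X (g * k)%N).
have X'0 : X' 0%N = 0 by rewrite exponents_ofE muln0 X0 if_same.
have uS : uniq S.
  rewrite map_inj_in_uniq ?fset_uniq // => a b aX bX ab.
  by rewrite -(divnK (gX a aX)) -(divnK (gX b bX)) ab.
exists (eta_prod X'), g; split => //.
- by exists X'.
- move=> fX'; have XX' : X = X'.
    by apply: expands_inj fX _; rewrite -fX'; exact: expands_eta_prod.
  (* Under h = f the support is stable under division by g, so every power of g divides each of its
     elements. *)
  have pow n a : a \in finsupp X -> (g ^ n %| a)%N.
    elim: n a => [|n IH] a aX; first by rewrite dvd1n.
    rewrite -(divnK (gX a aX)) expnSr dvdn_pmul2r //; apply: IH.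
    have aS : (a %/ g)%N \in S by exact: map_f.
    by rewrite XX' finsupp_exponents_of aS mulnC divnK ?gX // -mem_finsupp.
  have d0 : (0 < d)%N := allP (finsupp_gt0 X0) d dX.
  have := dvdn_leq d0 (pow d d dX); rewrite leqNgt ltn_expl //.
  by rewrite ltn_neqAle eq_sym g1.
move=> z w wz; rewrite fE /eta_prod.
rewrite (@big_exponents_of _ _ _ _ _ (fun d x => eta (d%:R * val w) ^ x)) //.
rewrite big_map big_seq [RHS]big_seq; apply: eq_bigr => a aX.
by rewrite wz mulrA -natrM divnK ?gX // mulnC divnK ?gX.
Qed.

Lemma simple_exponents_bounded (k : int) : exists B r : nat, forall f,
  simple_holomorphic_eta_quotient f -> has_weight f (k%:~R / 2) ->
  exists2 X, expands f X & forall d, `|X d| <= r%:Z /\ (d \in finsupp X -> (d <= B)%N).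
Proof.
have [r normP] := exponent_norm_bound k.
(* Clusters start as single points, of box size 1, and there are at most r of them; the same r
   bounds the norm in the merging threshold. *)
exists (merge_bound r r 1), r => f [[X fX holX] prim [N [X2 fX2 levX2] irr]] [X1 fX1 wX1].
have {}irr : ~ factorizable_on (exp_level X) f.
  by rewrite (expands_inj fX fX2) levX2.
have {fX1}XX1 := expands_inj fX1 fX; rewrite XX1 in wX1.
have [X0 fE] := fX; exists X => //.
have pot := (holomorphic_potentialP X0).1 holX.
have sumX : \sum_(d <- finsupp X) X d = k.
  apply: (@intr_inj rat); apply: (@mulIf _ (2%:R)^-1) => //.
have normX := normP _ _ (fset_uniq _) (finsupp_gt0 X0) pot sumX.
have le_norm d : `|X d| <= r%:Z.
  have [dX|] := boolP (d \in finsupp X); last by rewrite memNfinsupp => /eqP ->; rewrite normr0.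
  apply: le_trans normX; rewrite (big_rem d) //= lerDl.
  by apply: sumr_ge0.
have size_le : (size (finsupp X) <= r)%N.
  rewrite -lez_nat; apply: le_trans normX.
  have -> : (size (finsupp X))%:Z = \sum_(d <- finsupp X) 1.
    by rewrite big_const_seq count_predT iter_addr addr0 natz.
  rewrite big_seq [leRHS]big_seq.
  apply: ler_sum => d; rewrite mem_finsupp => dX.
  by rewrite -gtz0_ge1 normr_gt0.
move=> d; split; first exact: le_norm.
move=> dX.
have := @splits_or_boxed _ _ _ (finsupp_gt0 X0) normX pot r 1%N id isT.
case.
- by rewrite map_id (leq_trans (size_undup _)) // ltnW.
- move=> x; rewrite map_id => xX; exists x, x; split => //.
  + exact: (allP (finsupp_gt0 X0)).
  + exact: (allP (finsupp_gt0 X0)).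
  + by rewrite mul1n.
  + by move=> y _ /eqP ->; rewrite dvdnn.
- by move/(splits_factorizable fX)/irr.
move=> [g [l [g0 gl l0 lb box]]].
(* The lower end g of the box divides the whole support, so primitivity makes it 1, and the upper
   end l is bounded. *)
have g1 : g = 1%N.
  apply: (primitive_gcd prim fX) => //; first by apply/fset0Pn; exists d.
  by move=> a aX; have /andP[] := box a aX isT.
have /andP[_ dl] := box d dX isT.
by apply: leq_trans (dvdn_leq l0 dl) _; rewrite g1 muln1 in lb.
Qed.

End Main.

Theorem mainTheorem1 (R : realType) (k : int) :
  finite_set [set f : upper_half_plane R -> R[i] |
    simple_holomorphic_eta_quotient f /\ has_weight f (k%:~R / 2)].
Proof.
have [B [r bound]] := simple_exponents_bounded R k.
(* Exponents at d <= B are shifted by r into 0, ..., 2 r, so the set lies in the image of a finite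
   type. *)
pose F (phi : {ffun 'I_B.+1 -> 'I_(2 * r).+1}) : upper_half_plane R -> R[i] :=
  eta_prod (exponents_of (iota 0 B.+1) (fun d => (phi (inord d) : nat)%:Z - r%:Z)).
apply: (@sub_finite_set _ _ (F @` setT)); last exact/finite_image/finite_finset.
move=> f /= [sf wf]; have [X [X0 fX] XP] := bound f sf wf.
exists [ffun d : 'I_B.+1 => inord (absz (X d + r%:Z))] => //.
apply/funext => z; rewrite fX /F; congr (eta_prod _ z); apply/fsfunP => d.
rewrite exponents_ofE mem_iota add0n ltnS /=; case: leqP => dB; last first.
  by rewrite fsfun_dflt //; apply/negP => /(XP d).2; rewrite leqNgt dB.
have := (XP d).1; rewrite ler_norml => /andP[lo hi].
by rewrite ffunE inordK (inordK dB) //; lia.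
Qed.
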